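(* Consider the system $x(s+1)=(1-a(s))x(s)+a(s)[P(s)x(s)+u(s)]$, $s=0,1,\ldots$, in $\mathbb{R}^n$, satisfying (A1) and one of the following four cases: i) $\widetilde{\rho}_{\max}(P)<1$; ii) $\widetilde{\rho}_{\min}(P)>1$; iii) $\widetilde{\rho}_{\max}(P)=1$ with (A3); iv) $\widetilde{\rho}_{\min}(P)=1$ with (A3). Let $\beta>0$, $\gamma\in(\frac12,1]$, and let $\alpha$ be a sufficiently large positive number (i.e. the conclusion holds for all $\alpha$ above some threshold depending on $P$). Choose $a(s)=\frac{\alpha}{(s+\beta)^\gamma}$ if $\widetilde{\rho}_{\max}(P)\le 1$, and $a(s)=\frac{-\alpha}{(s+\beta)^\gamma}$ if $\widetilde{\rho}_{\min}(P)\ge 1$. Then for any initial state, $$\mathbb{E}\|x(s)-x\|_2^2=\begin{cases}O(s^{-\gamma}), & \text{if }\widetilde{\rho}_{\max}(P)<1\text{ or }\widetilde{\rho}_{\min}(P)>1,\\ O(s^{1-2\gamma}), & \text{if }\widetilde{\rho}_{\max}(P)=1\text{ or }\widetilde{\rho}_{\min}(P)=1,\end{cases}$$ where $x$ is a mean square limit of $x(s)$, given as follows. In cases i) and ii), $x=(I_n-P)^{-1}u$. In cases iii) and iv), $x=H^{-1}y$, where $\bar y$ is a random vector with $\mathbb{E}\bar y=\overline{Hx(0)}$ and $\mathbb{E}\|\bar y\|_2^2<\infty$, and $\underline{y}=(I_{n-r}-\underline{D})^{-1}\underline{Hu}$.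
   Context: Here $P(s)\in\mathbb{R}^{n\times n}$ and $u(s)\in\mathbb{R}^n$, $s\ge 0$, are random matrices and vectors on a common probability space, $a(s)\in\mathbb{R}$ is the gain, and $x(0)\in\mathbb{R}^n$ is the initial state. For $A\in\mathbb{R}^{n\times n}$ with eigenvalues $\lambda_i(A)$, $\widetilde{\rho}_{\max}(A):=\max_i \mathrm{Re}(\lambda_i(A))$ and $\widetilde{\rho}_{\min}(A):=\min_i\mathrm{Re}(\lambda_i(A))$. (A1): there exist a matrix $P\in\mathbb{R}^{n\times n}$ and a vector $u\in\mathbb{R}^n$ such that $\mathbb{E}[P(s)\,|\,x(s)]=P$ and $\mathbb{E}[u(s)\,|\,x(s)]=u$ for any $s\ge 0$ and $x(s)\in\mathbb{R}^n$; also $\mathbb{E}[\|P(s)\|_2^2\,|\,x(s)]$ and $\mathbb{E}[\|u(s)\|_2^2\,|\,x(s)]$ are uniformly bounded. (A3): any eigenvalue of $P$ whose real part is $1$ equals $1$, the eigenvalue $1$ has the same algebraic and geometric multiplicities, and $\xi^T u=0$ for any left eigenvector $\xi^T$ of $P$ corresponding to the eigenvalue $1$. In cases iii) and iv), $r$ is the algebraic multiplicity of the eigenvalue $1$ of $P$, and $H\in\mathbb{C}^{n\times n}$ is an invertible matrix with $P=H^{-1}DH$, where $D=\mathrm{diag}(I_r,\underline{D})$ is the Jordan normal form of $P$ arranged so that the eigenvalue $1$ occupies the first $r$ diagonal entries and $\underline{D}\in\mathbb{C}^{(n-r)\times(n-r)}$. For $y\in\mathbb{C}^n$, $\bar{y}:=(y_1,\ldots,y_r)^\top$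 and $\underline{y}:=(y_{r+1},\ldots,y_n)^\top$ (similarly for $\overline{Hx(0)}$ and $\underline{Hu}$). $x(s)$ converges to a random vector $x$ in mean square if $\mathbb{E}\|x\|_2^2<\infty$ and $\lim_{s\to\infty}\mathbb{E}\|x(s)-x\|_2^2=0$. For positive sequences, $g_1(s)=O(g_2(s))$ means $g_1(s)\le c\,g_2(s)$ for some constant $c>0$ (here for all $s\geq 1$).
   Formalization: In cases iii) and iv) it is additionally assumed that E[P(s)|x(0),...,x(s)]=P and E[u(s)|x(0),...,x(s)]=u; with (A1) conditioning on x(s) alone, x(s) need not have a mean square limit (e.g. n=1, P(s)=1, Gaussian u(s) independent of x(s)). *)

(* Defs.v *)
From HB Require Import structures.
From mathcomp Require Import all_boot all_order all_algebra.
From mathcomp Require Import all_classical all_reals all_analysis.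
From mathcomp Require Import complex.

Set Implicit Arguments.
Unset Strict Implicit.
Unset Printing Implicit Defensive.

Import Order.TTheory GRing.Theory Num.Theory.
Import numFieldNormedType.Exports.

Local Open Scope classical_set_scope.
Local Open Scope ring_scope.
Local Open Scope complex_scope.

Section Spectrum.
Context {R : realType}.

Definition mxC {m n : nat} (A : 'M[R]_(m, n)) : 'M[R[i]]_(m, n) :=
  map_mx (fun t : R => t%:C) A.

(* For n > 0 this set is finite and nonempty, so that its sup and inf below
   are the maximum and the minimum. *)
Definition re_spectrum {n : nat} (A : 'M[R]_n) : set R :=
  [set complex.Re l | l in [set l : R[i] | eigenvalue (mxC A) l]].

Definition rho_max {n : nat} (A : 'M[R]_n) : R := sup (re_spectrum A).
Definition rho_min {n : nat} (A : 'M[R]_n) : R := inf (re_spectrum A).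

Definition alg_mult {n : nat} (A : 'M[R[i]]_n) (l : R[i]) : nat :=
  mup l (char_poly A).

(* [eigenspace] consists of the row eigenvectors of A; it has the same
   dimension n - \rank (A - l%:M) as the space of column eigenvectors. *)
Definition geo_mult {n : nat} (A : 'M[R[i]]_n) (l : R[i]) : nat :=
  \rank (eigenspace A l).

Definition jordan_block (k : nat) (l : R[i]) : 'M[R[i]]_k :=
  \matrix_(i, j) (if j == i then l else ((j : nat) == i.+1)%:R).

Definition jordan_form {n : nat} (J : 'M[R[i]]_n) : Prop :=
  exists (k : nat) (p : 'I_k -> nat) (l : 'I_k -> R[i])
         (e : (\sum_i p i)%N = n),
    (forall i, (0 < p i)%N) /\
    J = castmx (e, e) (\mxdiag_i jordan_block (p i) (l i)).

Definition A3 {n : nat} (P : 'M[R]_n) (u : 'cV[R]_n) : Prop :=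
  [/\ forall l : R[i], eigenvalue (mxC P) l -> complex.Re l = 1 -> l = 1,
      alg_mult (mxC P) 1 = geo_mult (mxC P) 1
    & forall xi : 'rV[R[i]]_n,
        xi != 0 -> xi *m mxC P = xi -> xi *m mxC u = 0].

End Spectrum.

Section Norms.
Context {R : realType}.

Definition norm2 {n : nat} (v : 'cV[R]_n) : R :=
  Num.sqrt (\sum_i v i 0 ^+ 2).

Definition norm2C {n : nat} (v : 'cV[R[i]]_n) : R :=
  Num.sqrt (\sum_i Normc.normc (v i 0) ^+ 2).

Definition opnorm2 {m n : nat} (A : 'M[R]_(m, n)) : R :=
  sup [set norm2 (A *m v) | v in [set v : 'cV[R]_n | norm2 v = 1]].

End Norms.

Section RandomMatrices.
Context {d : measure_display} {Omega : measurableType d} {R : realType}.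
Variable Pr : probability Omega R.

Definition random_mx {m n : nat} (A : Omega -> 'M[R]_(m, n)) : Prop :=
  forall i j, measurable_fun setT (fun w => A w i j).

Definition random_mxC {m n : nat} (A : Omega -> 'M[R[i]]_(m, n)) : Prop :=
  forall i j, measurable_fun setT (fun w => complex.Re (A w i j)) /\
              measurable_fun setT (fun w => complex.Im (A w i j)).

Definition expectation_mxC {m n : nat}
    (A : Omega -> 'M[R[i]]_(m, n)) (B : 'M[R[i]]_(m, n)) : Prop :=
  forall i j,
    'E_Pr[fun w => complex.Re (A w i j)]%E = (complex.Re (B i j))%:E /\
    'E_Pr[fun w => complex.Im (A w i j)]%E = (complex.Im (B i j))%:E.

Definition sigma_of (F : set (Omega -> R)) : set (set Omega) :=
  <<s \bigcup_(f in F) preimage_set_system setT f measurable >>.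

(* Y is a version of the conditional expectation E[X | G]. *)
Definition is_condexp (G : set (set Omega)) (X Y : Omega -> R) : Prop :=
  [/\ Pr.-integrable setT (EFin \o X),
      Pr.-integrable setT (EFin \o Y),
      forall B : set R, measurable B -> G (Y @^-1` B)
    & forall A, G A ->
        (\int[Pr]_(w in A) (Y w)%:E = \int[Pr]_(w in A) (X w)%:E)%E].

Definition condexp_mx_cst {m n : nat} (G : set (set Omega))
    (A : Omega -> 'M[R]_(m, n)) (B : 'M[R]_(m, n)) : Prop :=
  forall i j, is_condexp G (fun w => A w i j) (cst (B i j)).

Section Process.
Context {n : nat}.
Variable x : nat -> Omega -> 'cV[R]_n.

(* sigma(x(s)), generated by the coordinates of x(s) *)
Definition sigma_state (s : nat) : set (set Omega) :=
  sigma_of [set (fun w => x s w i 0) | i in [set: 'I_n]].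

(* sigma(x(0), ..., x(s)) *)
Definition sigma_history (s : nat) : set (set Omega) :=
  sigma_of [set f | exists k i, (k <= s)%N /\ f = (fun w => x k w i 0)].

Definition trajectory (a : nat -> R) (Ps : nat -> Omega -> 'M[R]_n)
    (us : nat -> Omega -> 'cV[R]_n) (x0 : 'cV[R]_n) : Prop :=
  (forall w, x 0%N w = x0) /\
  (forall s w, x s.+1 w =
     (1 - a s) *: x s w + a s *: (Ps s w *m x s w + us s w)).

Definition A1 (Ps : nat -> Omega -> 'M[R]_n) (us : nat -> Omega -> 'cV[R]_n)
    (P : 'M[R]_n) (u : 'cV[R]_n) : Prop :=
  [/\ forall s, condexp_mx_cst (sigma_state s) (Ps s) P,
      forall s, condexp_mx_cst (sigma_state s) (us s) u
    & exists M : R, forall s,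
        (exists2 Y, is_condexp (sigma_state s)
                      (fun w => opnorm2 (Ps s w) ^+ 2) Y
                  & {ae Pr, forall w, Y w <= M}) /\
        (exists2 Y, is_condexp (sigma_state s)
                      (fun w => norm2 (us s w) ^+ 2) Y
                  & {ae Pr, forall w, Y w <= M})].

(* The past of the state gives no more information on the means than the
   current state does. Conditioning on x(s) alone, as in A1, does not make
   the increments of x orthogonal. For instance, let n = 1, P(s) = 1 and
   u(s) = <w_s, g>, where g is a standard Gaussian vector of the plane and
   w_s is a unit vector orthogonal to v_s := \sum_(k < s) a(k) w_k. Then A1
   holds with P = 1 and u = 0, because u(s) is independent of
   x(s) = x(0) + <v_s, g>. However the direction of v_s turns by about
   a(s) / |v_s| at each step, and x(s) has no mean square limit when
   \sum_s a(s) = +oo and \sum_s a(s)^2 < +oo. *)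
Definition history_means (Ps : nat -> Omega -> 'M[R]_n)
    (us : nat -> Omega -> 'cV[R]_n) (P : 'M[R]_n) (u : 'cV[R]_n) : Prop :=
  (forall s, condexp_mx_cst (sigma_history s) (Ps s) P) /\
  (forall s, condexp_mx_cst (sigma_history s) (us s) u).

Definition ms_dist (X : Omega -> 'cV[R]_n) (s : nat) : \bar R :=
  'E_Pr[fun w => (norm2 (x s w - X w) ^+ 2)%R]%E.

Definition ms_cvg (X : Omega -> 'cV[R]_n) : Prop :=
  [/\ random_mx X,
      ('E_Pr[fun w => (norm2 (X w) ^+ 2)%R] < +oo)%E
    & ms_dist X s @[s --> \oo] --> 0%E].

(* E|x(s) - X|^2 = O(s^p) *)
Definition ms_rate (X : Omega -> 'cV[R]_n) (p : R) : Prop :=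
  exists2 c : R, 0 < c &
    forall s : nat, (1 <= s)%N -> (ms_dist X s <= (c * s%:R `^ p)%:E)%E.

End Process.
End RandomMatrices.

(* Main.v *)
(* Let k = 1 or -1 be the sign of the gain and B = k (P - 1), so that, with
   positive steps b(s) of order s^(-gamma) and a centered noise N(s),
     x(s+1) = x(s) + b(s) (B x(s) + k u) + b(s) k N(s).
   The spectrum of B lies in the open left half-plane, except possibly for a
   semisimple eigenvalue 0, whose spectral projector Q satisfies Q u = 0
   (Q = 0 in the strict cases). The matrix B - Q is then Hurwitz and admits a
   quadratic Lyapunov function |L v|^2, with rate c.
   Let x_inf be the solution of B x_inf = - k u with Q x_inf = 0. The error
   e = (1 - Q) x - x_inf satisfies
     E|L e(s+1)|^2 <= (1 - 2 c b(s)) E|L e(s)|^2 + O(b(s)^2),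
   since the noise is orthogonal to every affine function of x(s); this gives
   E|e(s)|^2 = O(s^(-gamma)) as soon as c alpha >= 1. The component Q x(s) is a
   martingale whose increments have second moment O(b(s)^2); hence it converges
   in mean square, at the rate of the tail of the sum of the b(t)^2, which is
   O(s^(1 - 2 gamma)). *)
Require Import Defs.
From HB Require Import structures.
From mathcomp Require Import all_boot all_order all_algebra.
From mathcomp Require Import all_classical all_reals all_analysis.
From mathcomp Require Import measurable_realfun complex ring lra.

Set Implicit Arguments.
Unset Strict Implicit.
Unset Printing Implicit Defensive.

Import Order.TTheory GRing.Theory Num.Theory.
Import numFieldNormedType.Exports.

Local Open Scope classical_set_scope.
Local Open Scope ring_scope.

(** * Linear algebra *)

(** The noise contains (P(s) - P) x(s), so its second moment is controlled only by 1 + E|x(s)|^2,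
    and the bounds O(b(s)^2) of the overview presuppose bounded moments. The circle is broken by
    adding the two recurrences: the sum of the moments of Q x and of L e grows by a factor at most 1
    + O(b(s)^2) per step, and 2 gamma > 1 keeps the product of these factors bounded. The rates come
    in a second pass, with the moments replaced by their bound. Conditioning on x(s) alone is enough
    for all one-step estimates, because Q x(s) and e(s) are affine in x(s). Only the increments of Q
    x over several steps call for [history_means]. Conditional expectations are given by their
    integrals on sets, whereas the weights met here, products of coordinates of the state, are
    unbounded. Hence the detour through extended integrals of nonnegative functions. The state is
    real but the Schur and Jordan bases are complex. The Lyapunov function becomes real by listing
    real and imaginary parts, and the projector is real by uniqueness. *)

Section DotProduct.
Context {R : realType}.

Definition dotv {n} (u v : 'cV[R]_n) : R := \sum_i u i 0 * v i 0.

Lemma dotvE n (u v : 'cV[R]_n) : dotv u v = (u^T *m v) 0 0.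
Proof. by rewrite mxE; apply: eq_bigr => i _; rewrite mxE. Qed.

Lemma dotvC n (u v : 'cV[R]_n) : dotv u v = dotv v u.
Proof. by apply: eq_bigr => i _; rewrite mulrC. Qed.

Lemma dotvDr n (u v w : 'cV[R]_n) : dotv u (v + w) = dotv u v + dotv u w.
Proof. by rewrite -big_split; apply: eq_bigr => i _; rewrite mxE mulrDr. Qed.

Lemma dotvZr n k (u v : 'cV[R]_n) : dotv u (k *: v) = k * dotv u v.
Proof. by rewrite mulr_sumr; apply: eq_bigr => i _; rewrite mxE mulrCA. Qed.

Lemma dotvDl n (u v w : 'cV[R]_n) : dotv (v + w) u = dotv v u + dotv w u.
Proof. by rewrite dotvC dotvDr !(dotvC u). Qed.

Lemma dotvZl n k (u v : 'cV[R]_n) : dotv (k *: u) v = k * dotv u v.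
Proof. by rewrite dotvC dotvZr dotvC. Qed.

Lemma dotvN n (u : 'cV[R]_n) : dotv (- u) (- u) = dotv u u.
Proof. by apply: eq_bigr => i _; rewrite !mxE mulrNN. Qed.

Lemma dotv_mulmxr m n (A : 'M[R]_(m, n)) u v :
  dotv u (A *m v) = dotv (A^T *m u) v.
Proof. by rewrite !dotvE trmx_mul trmxK mulmxA. Qed.

Lemma dotv_ge0 n (u : 'cV[R]_n) : 0 <= dotv u u.
Proof. by apply: sumr_ge0 => i _; rewrite -expr2 sqr_ge0. Qed.

Lemma sqr_le_dotv n (u : 'cV[R]_n) i : u i 0 ^+ 2 <= dotv u u.
Proof.
rewrite /dotv (bigD1 i)//= -expr2 lerDl.
by apply: sumr_ge0 => j _; rewrite -expr2 sqr_ge0.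
Qed.

Lemma dotv_le n (u v : 'cV[R]_n) : 2 * dotv u v <= dotv u u + dotv v v.
Proof.
rewrite -big_split mulr_sumr; apply: ler_sum => i _ /=.
by move: (u i 0) (v i 0) => a b; have := sqr_ge0 (a - b); nra.
Qed.

Lemma dotvD_le n (u v : 'cV[R]_n) :
  dotv (u + v) (u + v) <= 2 * (dotv u u + dotv v v).
Proof.
have := dotv_le u v; rewrite dotvDl !dotvDr (dotvC v u) => h; lra.
Qed.

Lemma norm2_sqr n (u : 'cV[R]_n) : norm2 u ^+ 2 = dotv u u.
Proof.
rewrite sqr_sqrtr; last by apply: sumr_ge0 => i _; exact: sqr_ge0.
by apply: eq_bigr => i _; rewrite expr2.
Qed.

Lemma dotv_CauchySchwarz n (u v : 'cV[R]_n) :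
  dotv u v ^+ 2 <= dotv u u * dotv v v.
Proof.
have [d0|d0] := eqVneq (dotv v v) 0.
  have v0 j : v j 0 = 0.
    apply/eqP; rewrite -sqrf_eq0 eq_le sqr_ge0 andbT -d0.
    exact: sqr_le_dotv.
  rewrite d0 mulr0 (_ : dotv u v = 0) ?expr0n//.
  by apply: big1 => j _; rewrite v0 mulr0.
have vv_gt0 : 0 < dotv v v by rewrite lt_def d0 dotv_ge0.
rewrite -(ler_pM2l vv_gt0) -subr_ge0.
have := dotv_ge0 (dotv v v *: u + (- dotv u v) *: v).
rewrite dotvDl !dotvDr !(dotvZl, dotvZr) (dotvC v u).
set a := dotv v v; set b := dotv u u; set c := dotv u v => h.
by rewrite (le_trans h)// le_eqVlt; apply/orP; left; apply/eqP; ring.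
Qed.

(** The constant is the squared Frobenius norm, by Cauchy-Schwarz on each row. *)
Lemma dotv_mulmx_le m n (A : 'M[R]_(m, n)) :
  exists2 K : R, 0 <= K & forall v, dotv (A *m v) (A *m v) <= K * dotv v v.
Proof.
exists (\sum_i dotv (row i A)^T (row i A)^T) => [|v].
  by apply: sumr_ge0 => i _; exact: dotv_ge0.
rewrite mulr_suml {1}/dotv; apply: ler_sum => i _.
rewrite -expr2 (_ : (A *m v) i 0 = dotv (row i A)^T v) ?dotv_CauchySchwarz//.
by rewrite mxE; apply: eq_bigr => j _; rewrite !mxE.
Qed.

End DotProduct.

(** * Complex vectors with their real inner product; contraction of triangular matrices *)

Section RealInnerProduct.
Context {R : realType}.
Local Notation C := R[i].

(** The real part of the Hermitian product, that is, the Euclidean product of R^(2n). It keeps the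
    dissipation estimate inside the reals. *)
Definition rdot {n} (z y : 'cV[C]_n) : R :=
  \sum_i (complex.Re (z i 0) * complex.Re (y i 0) +
          complex.Im (z i 0) * complex.Im (y i 0)).

Lemma Re_mulc (a b : C) : complex.Re (a * b) =
  complex.Re a * complex.Re b - complex.Im a * complex.Im b.
Proof. by case: a b => [? ?] [? ?]. Qed.

Lemma Im_mulc (a b : C) : complex.Im (a * b) =
  complex.Re a * complex.Im b + complex.Im a * complex.Re b.
Proof. by case: a b => [? ?] [? ?]. Qed.

Lemma Re_addc (a b : C) : complex.Re (a + b) = complex.Re a + complex.Re b.
Proof. by case: a b => [? ?] [? ?]. Qed.

Lemma Im_addc (a b : C) : complex.Im (a + b) = complex.Im a + complex.Im b.
Proof. by case: a b => [? ?] [? ?]. Qed.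

Lemma Re_sumc I (r : seq I) (F : I -> C) :
  complex.Re (\sum_(i <- r) F i) = \sum_(i <- r) complex.Re (F i).
Proof. by elim/big_rec2: _ => // i x y _ <-; rewrite Re_addc. Qed.

Lemma Im_sumc I (r : seq I) (F : I -> C) :
  complex.Im (\sum_(i <- r) F i) = \sum_(i <- r) complex.Im (F i).
Proof. by elim/big_rec2: _ => // i x y _ <-; rewrite Im_addc. Qed.

(** An upper bound of the modulus that avoids square roots and is exactly homogeneous for real
    factors. *)
Definition cnorm1 (a : C) : R := `|complex.Re a| + `|complex.Im a|.

Lemma rdot_entry_le (a z y : C) :
  complex.Re z * complex.Re (a * y) + complex.Im z * complex.Im (a * y) <=
  cnorm1 a * ((complex.Re z ^+ 2 + complex.Im z ^+ 2) +
              (complex.Re y ^+ 2 + complex.Im y ^+ 2)).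
Proof.
rewrite /cnorm1 Re_mulc Im_mulc; move: (complex.Re a) (complex.Im a) => p q.
move: (complex.Re z) (complex.Im z) (complex.Re y) (complex.Im y) => b c d e.
have /ler_normlP[p1 p2] := lexx `|p|; have /ler_normlP[q1 q2] := lexx `|q|.
set N := _ + (d ^+ 2 + _).
have h1 : `|b * d + c * e| <= N.
  by apply/ler_normlP; rewrite /N; split;
    have := sqr_ge0 (b + d); have := sqr_ge0 (c + e);
    have := sqr_ge0 (b - d); have := sqr_ge0 (c - e);
    have := sqr_ge0 b; have := sqr_ge0 c; have := sqr_ge0 d; have := sqr_ge0 e;
    nra.
have h2 : `|c * d - b * e| <= N.
  by apply/ler_normlP; rewrite /N; split;
    have := sqr_ge0 (c + d); have := sqr_ge0 (b + e);
    have := sqr_ge0 (c - d); have := sqr_ge0 (b - e);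
    have := sqr_ge0 b; have := sqr_ge0 c; have := sqr_ge0 d; have := sqr_ge0 e;
    nra.
rewrite (_ : _ + _ = p * (b * d + c * e) + q * (c * d - b * e)); last by ring.
rewrite mulrDl lerD// (le_trans (ler_norm _))// normrM ler_wpM2l//.
Qed.

(* Conjugating by powers of a small [eps] shrinks the off-diagonal entries. *)
Lemma trig_contraction n (A : 'M[C]_n) (c : R) : 0 < c -> is_trig_mx A ->
  (forall i, complex.Re (A i i) <= - (2 * c)) ->
  exists2 s : 'rV[C]_n, (forall i, s 0 i != 0) &
    forall z, rdot z (\matrix_(i, j) (s 0 i * A i j / s 0 j) *m z) <=
      - c * rdot z z.
Proof.
move=> c_gt0 /is_trig_mxP A_trig A_diag.
pose M := \sum_i \sum_j cnorm1 (A i j).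
have cnorm1_ge0 a : 0 <= cnorm1 a by rewrite addr_ge0.
have M_ge i j : cnorm1 (A i j) <= M.
  rewrite /M (bigD1 i)//= (bigD1 j)//= -addrA lerDl addr_ge0//.
    by apply: sumr_ge0 => k _; exact: cnorm1_ge0.
  by apply: sumr_ge0 => k _; apply: sumr_ge0 => l _; exact: cnorm1_ge0.
have M_ge0 : 0 <= M.
  by apply: sumr_ge0 => k _; apply: sumr_ge0 => l _; exact: cnorm1_ge0.
pose m := n%:R : R; have m_ge0 : 0 <= m by [].
(* This denominator ensures both [eps <= 1] and [2 * m * (eps * M) <= c]; the second bound lets the
   off-diagonal entries consume half of the diagonal gap [2 * c]. *)
pose K := c + 2 * m * M + 1.
have mM_ge0 : 0 <= m * M by rewrite mulr_ge0.
have K_gt0 : 0 < K by rewrite /K; lra.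
pose eps := c / K.
have eps_gt0 : 0 < eps by rewrite divr_gt0.
have eps_le1 : eps <= 1.
  by rewrite ler_pdivrMr// mul1r /K; lra.
have eps_small : 2 * m * (eps * M) <= c.
  rewrite /eps (_ : _ * _ = c * (2 * m * M) / K); last by ring.
  rewrite ler_pdivrMr// ler_wpM2l// ?ltW// /K; lra.
have eC k : (eps ^+ k)%:C%C != 0 :> C.
  by rewrite fmorph_eq0 expf_neq0// gt_eqF.
exists (\row_i (eps ^+ i)%:C%C).
  by move=> i; rewrite mxE eC.
move=> z; pose N i := complex.Re (z i 0) ^+ 2 + complex.Im (z i 0) ^+ 2.
have N_ge0 i : 0 <= N i by rewrite addr_ge0 ?sqr_ge0.
(* Below the diagonal the scaled entry carries the factor [eps ^+ (i - j)], hence at most [eps]. The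
   nonnegative [eps * M] term is kept for all pairs, so that the double sum collapses to
   [2 * m * (eps * M)] times the squared norm. *)
pose f i j := (if i == j then - (2 * c) * N i else 0) + eps * M * (N i + N j).
have zzE : rdot z z = \sum_i N i.
  by apply: eq_bigr => i _; rewrite /N !expr2.
have : rdot z (\matrix_(i, j) ((\row_k (eps ^+ k)%:C%C) 0 i * A i j /
    (\row_k (eps ^+ k)%:C%C) 0 j) *m z) <= \sum_i \sum_j f i j.
  apply: ler_sum => i _; rewrite mxE Re_sumc Im_sumc !mulr_sumr -big_split/=.
  apply: ler_sum => j _; rewrite !mxE.
  have eM_ge0 : 0 <= eps * M * (N i + N j).
    apply: mulr_ge0; last exact: addr_ge0.
    by apply: mulr_ge0; rewrite // ltW.
  rewrite /f; case: (ssrnat.ltngtP i j) => [ij|ij|ij].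
  - rewrite A_trig// mulr0 !mul0r/= !mulr0 addr0 ifN ?add0r//.
    by apply/eqP => h; rewrite h ltnn in ij.
  - rewrite ifN; last by apply/eqP => h; rewrite h ltnn in ij.
    rewrite add0r (le_trans (rdot_entry_le _ _ _))// ler_wpM2r ?addr_ge0 ?sqr_ge0//.
    have -> : (eps ^+ i)%:C%C * A i j / (eps ^+ j)%:C%C =
        (eps ^+ (i - j))%:C%C * A i j :> C.
      rewrite -{1}(subnK (ltnW ij)) exprD rmorphM/=.
      by rewrite mulrAC mulfK.
    rewrite /cnorm1 Re_mulc Im_mulc/= !mul0r subr0 addr0 !normrM -mulrDr.
    rewrite ler_pM//; last exact: M_ge.
    rewrite ger0_norm ?exprn_ge0 ?(ltW eps_gt0)//.
    rewrite -(subnSK ij) exprS ler_piMr ?(ltW eps_gt0)//.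
    by rewrite exprn_ile1// ltW.
  - have eij : i = j by exact: val_inj.
    rewrite {}eij in eM_ge0 *.
    rewrite eqxx (_ : (eps ^+ j)%:C%C * A j j / (eps ^+ j)%:C%C = A j j);
      last by rewrite mulrAC (divff (eC j)) mul1r.
    apply: le_trans (_ : - (2 * c) * N j <= _); last by rewrite lerDl.
    rewrite Re_mulc Im_mulc [leLHS](_ : _ = complex.Re (A j j) * N j); last first.
      by rewrite /N; ring.
    by rewrite ler_wpM2r.
move=> /le_trans; apply.
rewrite zzE [leLHS](_ : _ = - (2 * c) * (\sum_i N i) +
    2 * m * (eps * M) * (\sum_i N i)).
  by rewrite -mulrDl ler_wpM2r ?sumr_ge0//; lra.
have fE i : \sum_j f i j =
    - (2 * c) * N i + eps * M * (m * N i + \sum_j N j).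
  rewrite /f big_split/= -big_mkcond/= (big_pred1 i); last first.
    by move=> j; rewrite /= eq_sym.
  rewrite -mulr_sumr big_split/= sumr_const card_ord -(mulr_natl (N i)).
  by [].
under eq_bigr do rewrite fE.
move: N {N_ge0 f zzE fE} => N; rewrite big_split/= -!mulr_sumr big_split/=.
rewrite -mulr_sumr sumr_const card_ord.
by rewrite -(mulr_natl (\sum_j N j)) -/m; ring.
Qed.

End RealInnerProduct.

(** * Quadratic Lyapunov functions of Hurwitz matrices *)

Section Lyapunov.
Context {R : realType}.
Local Notation C := R[i].

Lemma mxCM m n p (A : 'M[R]_(m, n)) (B : 'M[R]_(n, p)) :
  mxC (A *m B) = mxC A *m mxC B.
Proof. exact: (map_mxM (real_complex R)). Qed.

Lemma char_poly_conj (F : fieldType) n (U A : 'M[F]_n) : U \in unitmx ->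
  char_poly (invmx U *m A *m U) = char_poly A.
Proof.
move=> Uu; rewrite /char_poly /char_poly_mx !map_mxM/= -/(map_mx polyC).
have UV : map_mx polyC (invmx U) *m map_mx polyC U = 1%:M.
  by rewrite -map_mxM mulVmx// map_mx1.
rewrite -[X in X - _](_ : map_mx polyC (invmx U) *m 'X%:M *m map_mx polyC U = _).
  by rewrite -mulmxBl -mulmxBr !det_mulmx mulrAC -det_mulmx UV det1 mul1r.
by rewrite scalar_mxC -mulmxA UV mulmx1.
Qed.

(** The factor 2 is the margin that [trig_contraction] spends on the off-diagonal entries. *)
Lemma finite_negative_gap n (f : 'I_n -> R) : (forall i, f i < 0) ->
  exists2 c : R, 0 < c & forall i, f i <= - (2 * c).
Proof.
case: n f => [|n] f f_lt0; first by exists 1 => // -[].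
have [i _ f_max] := arg_maxP f (erefl : xpredT (@ord0 n)).
exists (- f i / 2) => [|j]; first by rewrite divr_gt0// oppr_gt0.
by have := f_max j erefl; rewrite mulrCA divff// mulr1 opprK.
Qed.

(** Applied to a real vector, it lists the real and imaginary parts of its complex image. This is
    why the Lyapunov matrix has twice as many rows as columns. *)
Definition realify m n (T : 'M[C]_(m, n)) : 'M[R]_(m + m, n) :=
  col_mx (map_mx (@complex.Re R) T) (map_mx (@complex.Im R) T).

Lemma mulmx_mxC_Re m n (T : 'M[C]_(m, n)) (v : 'cV[R]_n) i :
  complex.Re ((T *m mxC v) i 0) = (map_mx (@complex.Re R) T *m v) i 0.
Proof.
rewrite !mxE Re_sumc; apply: eq_bigr => j _.
by rewrite !mxE Re_mulc/= mulr0 subr0.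
Qed.

Lemma mulmx_mxC_Im m n (T : 'M[C]_(m, n)) (v : 'cV[R]_n) i :
  complex.Im ((T *m mxC v) i 0) = (map_mx (@complex.Im R) T *m v) i 0.
Proof.
rewrite !mxE Im_sumc; apply: eq_bigr => j _.
by rewrite !mxE Im_mulc/= mulr0 add0r.
Qed.

Lemma dotv_realify m n (T : 'M[C]_(m, n)) (u v : 'cV[R]_n) :
  dotv (realify T *m u) (realify T *m v) = rdot (T *m mxC u) (T *m mxC v).
Proof.
rewrite /dotv big_split_ord/= /rdot big_split/= /realify.
by congr (_ + _); apply: eq_bigr => i _;
  rewrite !mul_col_mx ?col_mxEu ?col_mxEd -?mulmx_mxC_Re -?mulmx_mxC_Im.
Qed.

(** Provides coercivity: the left inverse bounds |v| by a multiple of the Lyapunov norm. It computes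
    the real part of [invmx T *m (T *m mxC v)]. *)
Lemma realify_left_inverse n (T : 'M[C]_n) : T \in unitmx ->
  exists M : 'M[R]_(n, n + n), forall v : 'cV[R]_n, M *m (realify T *m v) = v.
Proof.
move=> Tu; exists (row_mx (map_mx (@complex.Re R) (invmx T))
                          (- map_mx (@complex.Im R) (invmx T))) => v.
rewrite mul_col_mx mul_row_col; apply/matrixP => i j; rewrite ord1.
transitivity (complex.Re ((invmx T *m (T *m mxC v)) i 0)); last first.
  by rewrite mulKmx// mxE.
rewrite [in RHS]mxE Re_sumc mulNmx [LHS]mxE [X in _ + X = _]mxE.
rewrite [X in X - _]mxE [X in _ - X]mxE -sumrB; apply: eq_bigr => k _ /=.
by rewrite Re_mulc mulmx_mxC_Re mulmx_mxC_Im !mxE.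
Qed.

Definition hurwitz n (B : 'M[R]_n) :=
  forall l : C, eigenvalue (mxC B) l -> complex.Re l < 0.

(** No Lyapunov equation is solved: [B] is brought to triangular form by a unitary matrix, then a
    diagonal scaling makes the triangular matrix dissipative, and [L] is the real form of the
    combined change of basis. *)
Lemma hurwitz_lyapunov n (B : 'M[R]_n) : (0 < n)%N -> hurwitz B ->
  exists (L : 'M[R]_(n + n, n)) (c K : R), [/\ 0 < c, 0 <= K,
    forall v, dotv (L *m v) (L *m (B *m v)) <= - c * dotv (L *m v) (L *m v) &
    forall v, dotv v v <= K * dotv (L *m v) (L *m v)].
Proof.
move=> n_gt0 B_hurwitz; have [U /unitarymx_unit Uu] := Schur (mxC B) n_gt0.
rewrite /similar_to conjumx//; set A := _ *m invmx U => A_trig.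
have [|c c_gt0 A_diag] := @finite_negative_gap n (fun i => complex.Re (A i i)).
  move=> i; apply: B_hurwitz; rewrite eigenvalue_root_char.
  suff -> : char_poly (mxC B) = char_poly A.
    rewrite char_poly_trig// /root horner_prod (bigD1 i)//=.
    by rewrite hornerXsubC subrr mul0r.
  have -> : mxC B = invmx U *m A *m U.
    by rewrite /A !mulmxA mulVmx// mul1mx mulmxKV.
  exact: char_poly_conj.
have [s s_neq0 s_le] := trig_contraction c_gt0 A_trig A_diag.
pose T := diag_mx s *m U.
have Tu : T \in unitmx.
  rewrite unitmx_mul Uu andbT unitmxE det_diag unitfE prodf_seq_neq0.
  by apply/allP => i _; rewrite s_neq0.
have TB v : T *m mxC (B *m v) =
    \matrix_(i, j) (s 0 i * A i j / s 0 j) *m (T *m mxC v).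
  rewrite mxCM /T -!mulmxA.
  have -> : U *m (mxC B *m mxC v) = A *m (U *m mxC v).
    by rewrite /A -!mulmxA mulKmx.
  clearbody A; rewrite !mulmxA; congr (_ *m _ *m _); apply/matrixP => i j.
  by rewrite mul_mx_diag mul_diag_mx !mxE mulfVK.
have [M ML] := realify_left_inverse Tu.
have [K K_ge0 MK] := dotv_mulmx_le M.
exists (realify T), c, K; split => // v.
  by rewrite !dotv_realify TB s_le.
by rewrite -{1 2}(ML v) MK.
Qed.

End Lyapunov.

(** * Spectral projectors at the eigenvalue 0, and bounds on the spectrum *)

Section SpectralProjector.
Context {R : realType}.
Local Notation C := R[i].

(** The projector onto the kernel of [B] along its image. Invertibility of [B - Q] forces [Q] to
    catch the whole kernel. This purely algebraic form is preserved by field morphisms, in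
    particular by conjugation. *)
Definition spectral_projector (F : fieldType) n (B Q : 'M[F]_n) :=
  [/\ Q *m Q = Q, Q *m B = 0, B *m Q = 0 & B - Q \in unitmx].

(** Both equal [Q *m Q']: multiplication by [B - Q'] on the right sends [Q] and [Q *m Q'] to the
    same matrix, and multiplication by [B - Q] on the left does so for [Q'] and [Q *m Q']. *)
Lemma spectral_projector_uniq (F : fieldType) n (B Q Q' : 'M[F]_n) :
  spectral_projector B Q -> spectral_projector B Q' -> Q = Q'.
Proof.
move=> [QQ QB BQ BQu] [QQ' QB' BQ' BQu'].
have -> : Q = Q *m Q'.
  apply: (can_inj (mulmxK BQu')).
  by rewrite !mulmxBr -!mulmxA QQ' QB' QB mulmx0.
symmetry; apply: (can_inj (mulKmx BQu)).
by rewrite !mulmxBl !mulmxA QQ BQ BQ' mul0mx.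
Qed.

Lemma map_spectral_projector (F F' : fieldType) (f : {rmorphism F -> F'}) n
    (B Q : 'M[F]_n) :
  spectral_projector B Q -> spectral_projector (map_mx f B) (map_mx f Q).
Proof.
move=> [QQ QB BQ BQu]; split; rewrite -?map_mxM -?map_mxB ?QQ ?QB ?BQ ?map_mx0//.
by rewrite map_unitmx.
Qed.

Lemma mxC_conjc m n (A : 'M[R]_(m, n)) : map_mx (@conjc R) (mxC A) = mxC A.
Proof. by apply/matrixP => i j; rewrite !mxE /= oppr0. Qed.

Lemma mxC_inj m n : injective (@mxC R m n).
Proof. by move=> A B /matrixP AB; apply/matrixP => i j; have := AB i j; rewrite !mxE => -[]. Qed.

Lemma conjc_fixed_mxC m n (A : 'M[C]_(m, n)) : map_mx (@conjc R) A = A ->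
  A = mxC (map_mx (@complex.Re R) A).
Proof.
move=> /matrixP AA; apply/matrixP => i j; have := AA i j; rewrite !mxE.
by case: (A i j) => a b [] /= bb; have -> : b = 0 by lra.
Qed.

(* The projector is real because it coincides with its conjugate. *)
Lemma spectral_projector_real n (B : 'M[R]_n) (Q : 'M[C]_n) :
  spectral_projector (mxC B) Q ->
  exists2 Q' : 'M[R]_n, Q = mxC Q' & spectral_projector B Q'.
Proof.
move=> BQ; have [Q' QE] : exists Q', Q = mxC Q'.
  exists (map_mx (@complex.Re R) Q).
  apply/conjc_fixed_mxC/(spectral_projector_uniq _ BQ).
  by rewrite -[mxC B]mxC_conjc; exact: map_spectral_projector.
exists Q' => //; move: BQ; rewrite {}QE => -[QQ QB BQ BQu]; split.
- by apply: mxC_inj; rewrite mxCM.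
- by apply: mxC_inj; rewrite mxCM QB /mxC map_mx0.
- by apply: mxC_inj; rewrite mxCM BQ /mxC map_mx0.
- by move: BQu; rewrite /mxC -map_mxB map_unitmx.
Qed.

Lemma hurwitz_unit n (B : 'M[R]_n) : hurwitz B -> B \in unitmx.
Proof.
move=> hB; rewrite -(map_unitmx (real_complex R)) -row_free_unit -kermx_eq0.
apply/negPn/negP => /rowV0Pn[v /sub_kermxP vB v0].
have /hB : eigenvalue (mxC B) 0.
  by apply/eigenvalueP; exists v => //; rewrite scale0r.
by rewrite ltxx.
Qed.

Lemma eigenvalue_affine (F : fieldType) n (P : 'M[F]_n) (k l : F) :
  k * k = 1 -> eigenvalue (k *: (P - 1%:M)) l -> eigenvalue P (1 + k * l).
Proof.
move=> kk /eigenvalueP[v vl v0]; apply/eigenvalueP; exists v => //.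
have := congr1 ( *:%R k) vl; rewrite -scalemxAr !scalerA kk scale1r.
rewrite mulmxBr mulmx1 scalerDl scale1r => <-.
by rewrite addrC subrK.
Qed.

(** Bounds the spectrum, without which [sup] and [inf] need not bound its elements. *)
Lemma eigenvalue_mxC_finite n (P : 'M[R]_n) :
  exists s : seq C, forall l, eigenvalue (mxC P) l -> l \in s.
Proof.
have [s sE] := closed_field_poly_normal (char_poly (mxC P)).
exists s => l; rewrite eigenvalue_root_char sE.
by rewrite (monicP (char_poly_monic _)) scale1r root_prod_XsubC.
Qed.

Lemma Re_seq_bounded (s : seq C) :
  exists M : R, forall l, l \in s -> `|complex.Re l| <= M.
Proof.
exists (\sum_(l <- s) `|complex.Re l|) => l ls.
by rewrite (big_rem l)//= lerDl sumr_ge0.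
Qed.

Lemma le_rho_max n (P : 'M[R]_n) (l : C) :
  eigenvalue (mxC P) l -> complex.Re l <= rho_max P.
Proof.
move=> Pl; apply: ub_le_sup; last by exists l.
have [s Ps] := eigenvalue_mxC_finite P; have [M sM] := Re_seq_bounded s.
by exists M => _ [k /= Pk <-]; rewrite (le_trans (ler_norm _))// sM// Ps.
Qed.

Lemma ge_rho_min n (P : 'M[R]_n) (l : C) :
  eigenvalue (mxC P) l -> rho_min P <= complex.Re l.
Proof.
move=> Pl; apply: ge_inf; last by exists l.
have [s Ps] := eigenvalue_mxC_finite P; have [M sM] := Re_seq_bounded s.
exists (- M) => _ [k /= Pk <-]; rewrite lerNl.
by rewrite (le_trans (ler_norm _))// normrN sM// Ps.
Qed.

Lemma rho_min_le_max n (P : 'M[R]_n) : (0 < n)%N -> rho_min P <= rho_max P.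
Proof.
move=> /(eigenvalue_closed (mxC P))[l Pl].
exact: (le_trans (ge_rho_min Pl) (le_rho_max Pl)).
Qed.

(* The sign [k = 1] is for spectra on the left of [Re = 1], and [k = -1] for
   spectra on its right. *)
Lemma hurwitz_off_line n (P : 'M[R]_n) (k : R) : k * k = 1 ->
  (forall l, eigenvalue (mxC P) l -> k * (complex.Re l - 1) < 0) ->
  hurwitz (k *: (P - 1%:M)).
Proof.
move=> kk kP l; rewrite /mxC map_mxZ/= map_mxB map_mx1 => /eigenvalue_affine.
rewrite -rmorphM kk => /(_ erefl)/kP.
rewrite Re_addc Re_mulc/= mul0r subr0 addrAC subrr add0r mulrA kk mul1r//.
Qed.

Lemma char_poly_1_block (F : fieldType) r m (D : 'M[F]_m) :
  char_poly (block_mx (1%:M : 'M[F]_r) 0 0 D) =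
  ('X - 1%:P) ^+ r * char_poly D.
Proof.
rewrite /char_poly char_block_diag_mx det_ublock; congr (_ * _).
rewrite -[LHS]/(char_poly 1%:M) char_poly_trig ?scalar_mx_is_trig//.
under eq_bigr do rewrite mxE eqxx.
by rewrite prodr_const card_ord.
Qed.

Section JordanSplitting.
Variables (n r m : nat) (e : n = (r + m)%N).
Variables (P : 'M[R]_n) (H : 'M[C]_n) (D : 'M[C]_m).
Hypothesis r_mult : r = alg_mult (mxC P) 1.
Hypothesis Hu : H \in unitmx.
Hypothesis PE : mxC P = invmx H *m
  castmx (esym e, esym e) (block_mx 1%:M 0 0 D : 'M[C]_(r + m)) *m H.

Lemma mxC_char_poly : char_poly (mxC P) = ('X - 1%:P) ^+ r * char_poly D.
Proof.
rewrite PE char_poly_conj// -char_poly_1_block.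
(* Written as [esym f], the equality can be eliminated by substituting [r + m] for [n], which turns
   the casts into identities. *)
have [f ef] : exists f : (r + m)%N = n, e = esym f by exists (esym e).
by rewrite ef; destruct f; rewrite castmx_id.
Qed.

Lemma eigenvalue_lower l : eigenvalue D l -> eigenvalue (mxC P) l.
Proof.
by rewrite !eigenvalue_root_char mxC_char_poly rootM => ->; rewrite orbT.
Qed.

(** The identity block already exhausts the algebraic multiplicity of 1; multiplicities add up in
    the product of characteristic polynomials, so none is left for [D]. *)
Lemma lower_unit : 1%:M - D \in unitmx.
Proof.
have : ~~ eigenvalue D 1.
  rewrite eigenvalue_root_char -dvdp_XsubCl XsubC_dvd; last first.
    by rewrite monic_neq0// char_poly_monic.
  move: r_mult; rewrite /alg_mult mxC_char_poly mupM; last 2 first.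
  - by rewrite expf_neq0// polyXsubC_eq0.
  - by rewrite monic_neq0// char_poly_monic.
  by rewrite mup_XsubCX eqxx => /eqP; rewrite -{1}[r]addn0 eqn_add2l => /eqP <-.
apply: contraNT; rewrite -row_free_unit -kermx_eq0.
move=> /rowV0Pn[v /sub_kermxP vD v0]; apply/eigenvalueP; exists v => //.
by move: vD; rewrite mulmxBr mulmx1 scale1r => /eqP; rewrite subr_eq0 => /eqP.
Qed.

End JordanSplitting.

End SpectralProjector.

(** * The projector and the limit in Jordan coordinates *)

Section JordanProjector.
Context {R : realType}.
Local Notation C := R[i].

Definition conjm (F : fieldType) n (H X : 'M[F]_n) := invmx H *m X *m H.

Lemma conjmM (F : fieldType) n (H X Y : 'M[F]_n) : H \in unitmx ->
  conjm H X *m conjm H Y = conjm H (X *m Y).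
Proof. by move=> Hu; rewrite /conjm !mulmxA mulmxK. Qed.

Lemma conjm1 (F : fieldType) n (H : 'M[F]_n) : H \in unitmx -> conjm H 1%:M = 1%:M.
Proof. by move=> Hu; rewrite /conjm mulmx1 mulVmx. Qed.

Lemma conjmB (F : fieldType) n (H X Y : 'M[F]_n) :
  conjm H (X - Y) = conjm H X - conjm H Y.
Proof. by rewrite /conjm mulmxBr mulmxBl. Qed.

Lemma conjmZ (F : fieldType) n (H X : 'M[F]_n) k : conjm H (k *: X) = k *: conjm H X.
Proof. by rewrite /conjm -scalemxAr -scalemxAl. Qed.

Lemma conjm_unit (F : fieldType) n (H X : 'M[F]_n) : H \in unitmx ->
  (conjm H X \in unitmx) = (X \in unitmx).
Proof. by move=> Hu; rewrite !unitmx_mul unitmx_inv Hu andbT. Qed.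

Lemma conjm_affine_block (F : fieldType) r m (H : 'M[F]_(r + m)) (D : 'M[F]_m) (k : F) :
  H \in unitmx ->
  k *: (conjm H (block_mx 1%:M 0 0 D) - 1%:M) =
  conjm H (block_mx 0 0 0 (k *: (D - 1%:M))).
Proof.
move=> Hu; rewrite -{1}(conjm1 Hu) -conjmB -conjmZ scalar_mx_block opp_block_mx.
by rewrite add_block_mx scale_block_mx !subrr !scaler0.
Qed.

Lemma block_spectral_projector (F : fieldType) r m (H : 'M[F]_(r + m))
    (D : 'M[F]_m) (k : F) :
  H \in unitmx -> 1%:M - D \in unitmx -> k != 0 ->
  spectral_projector (k *: (conjm H (block_mx 1%:M 0 0 D) - 1%:M))
                     (conjm H (block_mx 1%:M 0 0 0)).
Proof.
move=> Hu Du k0; rewrite conjm_affine_block//; split.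
- by rewrite conjmM// mulmx_block !(mulmx0, mul0mx, mulmx1, addr0).
- rewrite conjmM// mulmx_block !(mulmx0, mul0mx, mulmx1, addr0).
  by rewrite block_mx_const /conjm mulmx0 mul0mx.
- rewrite conjmM// mulmx_block !(mulmx0, mul0mx, mulmx1, addr0).
  by rewrite block_mx_const /conjm mulmx0 mul0mx.
rewrite -conjmB conjm_unit// opp_block_mx add_block_mx !oppr0 !addr0 add0r.
rewrite unitmxE det_ublock unitrM -!unitmxE -scaleN1r !unitmxZ ?unitfE ?oppr_eq0 ?oner_eq0//.
by rewrite unitmx1 -opprB -scaleN1r unitmxZ ?unitfE ?oppr_eq0 ?oner_eq0.
Qed.

(** Subtracting the projector moves the eigenvalue 0 of the first block to -1 and leaves the second
    block alone; this is what makes [B - Q] Hurwitz. *)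
Lemma block_eigenvalue (F : fieldType) r m (H : 'M[F]_(r + m))
    (D : 'M[F]_m) (k l : F) : H \in unitmx -> k * k = 1 ->
  eigenvalue (k *: (conjm H (block_mx 1%:M 0 0 D) - 1%:M) -
              conjm H (block_mx 1%:M 0 0 0)) l ->
  l = -1 \/ eigenvalue D (1 + k * l).
Proof.
move=> Hu kk; rewrite conjm_affine_block// -conjmB opp_block_mx add_block_mx.
rewrite !oppr0 !addr0 add0r eigenvalue_root_char char_poly_conj//.
rewrite /char_poly char_block_diag_mx det_ublock rootM => /orP[].
  rewrite -[\det _]/(char_poly _) -eigenvalue_root_char => /eigenvalueP[v].
  rewrite mulmxN mulmx1 => vl v0; left; apply/eqP; rewrite -subr_eq0 opprK.
  by move/eqP: vl; rewrite eq_sym -subr_eq0 opprK -{2}[v]scale1r -scalerDl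
    scaler_eq0 (negPf v0) orbF.
rewrite -[\det _]/(char_poly _) -eigenvalue_root_char => /eigenvalue_affine.
by move=> /(_ kk); right.
Qed.

(** In Jordan coordinates the projector is an identity block, a priori a complex matrix;
    [spectral_projector_real] makes it act on the real state. *)
Lemma jordan_projector n r m (e : n = (r + m)%N) (P : 'M[R]_n) (H : 'M[C]_n)
    (D : 'M[C]_m) (k : R) :
  r = alg_mult (mxC P) 1 -> H \in unitmx ->
  mxC P = invmx H *m
    castmx (esym e, esym e) (block_mx 1%:M 0 0 D : 'M[C]_(r + m)) *m H ->
  k * k = 1 ->
  (forall l, eigenvalue (mxC P) l -> complex.Re l = 1 -> l = 1) ->
  (forall l, eigenvalue (mxC P) l -> k * (complex.Re l - 1) <= 0) ->
  exists Q : 'M[R]_n,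
  [/\ mxC Q = invmx H *m
        castmx (esym e, esym e) (block_mx 1%:M 0 0 0 : 'M[C]_(r + m)) *m H,
      spectral_projector (k *: (P - 1%:M)) Q &
      hurwitz (k *: (P - 1%:M) - Q)].
Proof.
move=> r_mult Hu PE kk A3P kP.
have Du := lower_unit r_mult Hu PE; have eigD := eigenvalue_lower r_mult Hu PE.
have [f ef] : exists f : (r + m)%N = n, e = esym f by exists (esym e).
move: P H Hu PE r_mult A3P kP eigD; rewrite ef; destruct f.
move=> P H Hu PE r_mult; rewrite /= !castmx_id in PE *
  => A3P kP eigD.
have k0 : k != 0 by apply: contraTneq (oner_neq0 R) => k0; rewrite -kk k0 mulr0 eqxx.
have kP1 : mxC (k *: (P - 1%:M)) = k%:C%C *: (conjm H (block_mx 1%:M 0 0 D) - 1%:M).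
  by rewrite /mxC map_mxZ map_mxB map_mx1 -/(mxC P) PE.
have : spectral_projector (mxC (k *: (P - 1%:M))) (conjm H (block_mx 1%:M 0 0 0)).
  by rewrite kP1; apply: block_spectral_projector; rewrite ?fmorph_eq0.
move=> /spectral_projector_real[Q QE PQ].
exists Q; split; [exact: esym QE|exact: PQ|move=> l].
rewrite /mxC map_mxB -/(mxC _) -/(mxC Q) -QE kP1 => Hl.
have kkC : k%:C%C * k%:C%C = 1 by rewrite -rmorphM kk.
have [->|] := block_eigenvalue Hu kkC Hl; first by rewrite /= ltrN10.
move=> Dl; have := kP _ (eigD _ Dl); rewrite le_eqVlt => /orP[|].
  (* On the line of real part 1 the only possible eigenvalue is 1, and it is not one of [D]. *)
  rewrite mulf_eq0 (negPf k0)/= subr_eq0 => /eqP /(A3P _ (eigD _ Dl)) l1.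
  have /negP[] : ~~ eigenvalue D 1.
    apply/negP => /eigenvalueP[v vD v0]; move/negP: v0; apply.
    rewrite -[v](mulmxK Du) mulmxBr mulmx1 vD scale1r subrr mul0mx//.
  by rewrite l1 in Dl.
by rewrite Re_addc Re_mulc/= mul0r subr0 addrAC subrr add0r mulrA kk mul1r.
Qed.

(** Turns the mean [Q *m x0] of the limiting martingale component into the mean required of its
    Jordan coordinates. *)
Lemma jordan_upper n r m (e : n = (r + m)%N) (Q : 'M[R]_n) (H : 'M[C]_n)
    (x : 'cV[R]_n) : H \in unitmx ->
  mxC Q = invmx H *m
    castmx (esym e, esym e) (block_mx 1%:M 0 0 0 : 'M[C]_(r + m)) *m H ->
  usubmx (castmx (e, erefl 1%N) (H *m mxC (Q *m x))) =
  usubmx (castmx (e, erefl 1%N) (H *m mxC x)).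
Proof.
have [f ef] : exists f : (r + m)%N = n, e = esym f by exists (esym e).
move: H Q x; rewrite ef; destruct f => H Q x Hu; rewrite /= !castmx_id => QE.
rewrite mxCM QE !mulmxA mulmxV// mul1mx -mulmxA -[X in _ *m X]vsubmxK.
by rewrite mul_block_col !mul0mx !addr0 mul1mx col_mxKu.
Qed.

(** In Jordan coordinates [z] has only its first [r] entries and [w] only the remaining ones. On the
    latter the equation [(1%:M - P) *m w = u] involves [1%:M - D] alone, which is inverted. *)
Lemma jordan_reconstruct n r m (e : n = (r + m)%N) (P Q : 'M[R]_n)
    (H : 'M[C]_n) (D : 'M[C]_m) (z w u : 'cV[R]_n) :
  H \in unitmx -> 1%:M - D \in unitmx ->
  mxC P = invmx H *m
    castmx (esym e, esym e) (block_mx 1%:M 0 0 D : 'M[C]_(r + m)) *m H ->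
  mxC Q = invmx H *m
    castmx (esym e, esym e) (block_mx 1%:M 0 0 0 : 'M[C]_(r + m)) *m H ->
  Q *m z = z -> Q *m w = 0 -> (1%:M - P) *m w = u ->
  mxC (z + w) = invmx H *m castmx (esym e, erefl 1%N)
    (col_mx (usubmx (castmx (e, erefl 1%N) (H *m mxC z)))
            (invmx (1%:M - D) *m dsubmx (castmx (e, erefl 1%N) (H *m mxC u)))).
Proof.
have [f ef] : exists f : (r + m)%N = n, e = esym f by exists (esym e).
move: H P Q z w u; rewrite ef; destruct f => H P Q z w u Hu Du.
rewrite /= !castmx_id => PE QE Qz Qw Pw.
have HQ (v : 'cV[R]_(r + m)) : H *m mxC (Q *m v) = col_mx (usubmx (H *m mxC v)) 0.
  rewrite mxCM QE !mulmxA mulmxV// mul1mx -mulmxA -[X in _ *m X]vsubmxK.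
  by rewrite mul_block_col !mul0mx !addr0 mul1mx.
have {}Qz : H *m mxC z = col_mx (usubmx (H *m mxC z)) 0 by rewrite -HQ Qz.
have {}Qw : usubmx (H *m mxC w) = 0.
  have := HQ w; rewrite Qw => /(congr1 usubmx); rewrite col_mxKu => <-.
  by rewrite /mxC map_mx0 mulmx0; apply/matrixP => i j; rewrite !mxE.
have {}Pw : (1%:M - D) *m dsubmx (H *m mxC w) = dsubmx (H *m mxC u).
  rewrite -Pw mxCM /mxC map_mxB map_mx1 -/(mxC P) PE.
  have -> : H *m ((1%:M - invmx H *m block_mx 1%:M 0 0 D *m H) *m mxC w) =
      H *m mxC w - block_mx 1%:M 0 0 D *m (H *m mxC w).
    by rewrite mulmxBl mul1mx mulmxBr -!mulmxA mulKVmx.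
  rewrite -[in RHS](vsubmxK (H *m mxC w)) Qw mul_block_col !mul0mx !mulmx0 !add0r.
  by rewrite opp_col_mx add_col_mx col_mxKd mulmxBl mul1mx.
rewrite -Pw mulKmx// -(mulKmx Hu (mxC _)); congr (_ *m _).
rewrite /mxC map_mxD mulmxDr -/(mxC z) -/(mxC w).
rewrite Qz -[X in _ + X = _]vsubmxK Qw add_col_mx add0r addr0 col_mxKu//.
Qed.

End JordanProjector.

(** * Gain sequences *)

Section RealPowers.
Context {R : realType}.
Implicit Types (t p x y : R).

Lemma ler_powR_neg p x y : p <= 0 -> 0 < x -> x <= y -> y `^ p <= x `^ p.
Proof.
move=> p0 x0 xy; have y0 := lt_le_trans x0 xy.
rewrite -(opprK p) !(powRN _ (- p)) lef_pV2 ?posrE ?powR_gt0//.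
by rewrite ge0_ler_powR ?nnegrE ?oppr_ge0// ltW.
Qed.

Lemma powR_neg_small p (eps : R) : p < 0 -> 0 < eps ->
  exists N : nat, forall s : nat, (N <= s)%N -> s%:R `^ p <= eps.
Proof.
move=> p0 e0; exists (Num.truncn (eps `^ p^-1)).+1 => s Ns.
have x0 : 0 < eps `^ p^-1 by rewrite powR_gt0.
have epsE : eps = (eps `^ p^-1) `^ p.
  by rewrite -powRrM mulVf ?lt_eqF// powRr1// ltW.
rewrite [leRHS]epsE.
apply: ler_powR_neg => //; first exact: ltW.
by rewrite (le_trans (ltW (truncnS_gt _)))// ler_nat.
Qed.

(** After division by t^(-g) the chain is 1 - t^(-g) <= 1 - 1/t <= t/(t+1) <= (t/(t+1))^g. Its two
    outer inequalities use g <= 1. *)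
Lemma powR_inv_step t (g : R) : 1 <= t -> 0 <= g <= 1 ->
  (t `^ g)^-1 * (1 - (t `^ g)^-1) <= ((t + 1) `^ g)^-1.
Proof.
move=> t1 /andP[g0 g1]; have t0 : 0 < t by lra.
have tt0 : 0 < t + 1 by lra.
pose y := t / (t + 1); have y0 : 0 < y by rewrite divr_gt0.
have y1 : y <= 1 by rewrite ler_pdivrMr//; lra.
have -> : ((t + 1) `^ g)^-1 = (t `^ g)^-1 * y `^ g.
  rewrite powRM ?invr_ge0 ?ltW// mulKf ?gt_eqF ?powR_gt0//.
  by rewrite -[(t + 1)^-1]powR_inv1 ?ltW// -powRrM mulN1r powRN.
rewrite ler_pM2l ?invr_gt0 ?powR_gt0//.
apply: le_trans (_ : y <= _); last by rewrite ger1_powR// y0.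
apply: le_trans (_ : 1 - t^-1 <= _).
  by rewrite lerD2l lerN2 lef_pV2 ?posrE ?powR_gt0// ler1_powR.
rewrite ler_pdivlMr// mulrDr mulr1 mulrBl mul1r mulVf ?gt_eqF//.
have : 0 < t^-1 by rewrite invr_gt0.
lra.
Qed.

(* Bernoulli's inequality, through [1 + x <= exp x] and [ln (1 + x) <= x]. *)
Lemma powR_telescope t (d : R) : 0 < t -> 0 <= d ->
  d * (t + 1) `^ (- d - 1) <= t `^ (- d) - (t + 1) `^ (- d).
Proof.
move=> t0 d0; have tt0 : 0 < t + 1 by lra.
have tN0 : t != 0 by rewrite gt_eqF.
have ttN0 : t + 1 != 0 by rewrite gt_eqF.
have -> : t `^ (- d) = (t + 1) `^ (- d) * expR (d * ln ((t + 1) / t)).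
  rewrite /powR !gt_eqF// -expRD ln_div ?posrE//; congr expR; ring.
rewrite powRD; last by rewrite ttN0 implybT.
rewrite powR_inv1 ?(ltW tt0)// -[X in _ - X]mulr1 -mulrBr mulrCA ler_pM2l ?powR_gt0//.
apply: le_trans (_ : d * ln ((t + 1) / t) <= _); last first.
  by have := expR_ge1Dx (d * ln ((t + 1) / t)); lra.
apply: ler_wpM2l => //.
have -> : ln ((t + 1) / t) = - ln (1 + - (t + 1)^-1).
  rewrite -lnV ?posrE; last first.
    by rewrite subr_gt0 invf_lt1//; lra.
  by rewrite (_ : 1 + - _ = t / (t + 1)) ?invf_div//; field.
rewrite lerNr; apply: le_ln1Dx.
by rewrite ltrN2 invf_lt1//; lra.
Qed.

End RealPowers.

(** * Recurrences driven by the gains *)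

Section GainSequence.
Context {R : realType}.
Variables (beta gamma : R).
Hypotheses (beta_gt0 : 0 < beta) (gamma_gt : 1 < 2 * gamma).
Hypothesis gamma_le1 : gamma <= 1.

Let gamma_gt0 : 0 < gamma.
Proof. by have := gamma_gt; lra. Qed.

Let tail_exponent_lt0 : 1 - 2 * gamma < 0.
Proof. by rewrite subr_lt0. Qed.

Definition gain (s : nat) : R := ((s%:R + beta) `^ gamma)^-1.
(** Up to a constant, a majorant of the sum of [gain t ^+ 2] over [t >= s]: by [gain_sqr_le] that
    sum is dominated by a telescoping one. *)
Definition gain_tail (s : nat) : R := (s%:R + beta) `^ (1 - 2 * gamma).

Lemma addn_beta_gt0 (s : nat) : 0 < s%:R + beta.
Proof. by rewrite ltr_wpDl. Qed.

Lemma gain_gt0 s : 0 < gain s.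
Proof. by rewrite invr_gt0 powR_gt0// addn_beta_gt0. Qed.

Lemma gain_tail_gt0 s : 0 < gain_tail s.
Proof. by rewrite powR_gt0// addn_beta_gt0. Qed.

Lemma gainE s : gain s = (s%:R + beta) `^ (- gamma).
Proof. by rewrite powRN. Qed.

Lemma gain_le s t : (s <= t)%N -> gain t <= gain s.
Proof.
move=> st; rewrite !gainE; apply: ler_powR_neg.
- by rewrite oppr_le0 ltW.
- exact: addn_beta_gt0.
- by rewrite lerD2r ler_nat.
Qed.

(** The gain decays so slowly that a contraction by [1 - gain s] preserves a bound proportional to
    it. *)
Lemma gain_step s : (1 <= s)%N -> gain s * (1 - gain s) <= gain s.+1.
Proof.
move=> s1; rewrite /gain -(natr1 s) addrAC; apply: powR_inv_step.
  by rewrite (@le_trans _ _ s%:R) ?ler1n// lerDl ltW.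
by rewrite (ltW gamma_gt0).
Qed.

Lemma gain_sqr_le : exists2 C : R, 0 < C &
  forall s, gain s ^+ 2 <= C * (gain_tail s - gain_tail s.+1).
Proof.
pose d := 2 * gamma - 1; have d0 : 0 < d by rewrite subr_gt0.
(* [powR_telescope] produces a power of [t + 1]; this factor converts it into a power of [t], since
   (t+1)/t <= 1 + 1/beta for t >= beta. *)
pose k := (1 + beta^-1) `^ (2 * gamma).
have k0 : 0 < k by rewrite powR_gt0// ltr_wpDr// invr_ge0 ltW.
exists (k / d) => [|s]; first by rewrite divr_gt0.
have t0 := addn_beta_gt0 s; have bt : beta <= s%:R + beta by rewrite lerDr.
rewrite gainE /gain_tail -(natr1 s) addrAC; move: (s%:R + beta) t0 bt => t t0 bt.
have tt0 : 0 < t + 1 by lra.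
rewrite -powR_mulrn ?powR_ge0// -powRrM.
have := powR_telescope t0 (ltW d0).
rewrite (_ : - d - 1 = - gamma * 2); last by rewrite /d; ring.
rewrite (_ : - d = 1 - 2 * gamma); last by rewrite /d; ring.
set X := _ - _ => dX.
apply: le_trans (_ : k * (t + 1) `^ (- gamma * 2) <= _); last first.
  by rewrite -mulrA ler_pM2l// ler_pdivlMl.
have t10 : 0 < 1 + t^-1 by rewrite addr_gt0// invr_gt0.
have -> : t + 1 = t * (1 + t^-1) by rewrite mulrDr mulr1 divff// gt_eqF.
rewrite (powRM _ (ltW t0) (ltW t10)).
rewrite mulrCA ler_pMr ?powR_gt0// /k.
rewrite (_ : - gamma * 2 = - (2 * gamma)); last by ring.
rewrite powRN ler_pdivlMr ?powR_gt0// mul1r.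
rewrite ge0_ler_powR ?nnegrE ?(ltW t10)//; first by rewrite mulr_ge0// ltW.
  by rewrite addr_ge0// invr_ge0 ltW.
by rewrite lerD2l lef_pV2.
Qed.

Lemma gain_le_powR s : (1 <= s)%N -> gain s <= s%:R `^ (- gamma).
Proof.
move=> s1; rewrite gainE; apply: ler_powR_neg.
- by rewrite oppr_le0 ltW.
- by rewrite ltr0n.
- by rewrite lerDl ltW.
Qed.

Lemma gain_tail_le_powR s : (1 <= s)%N -> gain_tail s <= s%:R `^ (1 - 2 * gamma).
Proof.
move=> s1; apply: ler_powR_neg.
- exact: ltW.
- by rewrite ltr0n.
- by rewrite lerDl ltW.
Qed.

Lemma gain_small (eps : R) : 0 < eps ->
  exists2 N, (1 <= N)%N & forall s, (N <= s)%N -> gain s <= eps.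
Proof.
move=> e0; have [|N NP] := @powR_neg_small _ (- gamma) eps _ e0.
  by rewrite oppr_lt0.
exists (maxn N 1) => [|s]; rewrite ?leq_maxr// geq_max => /andP[Ns s1].
by rewrite (le_trans (gain_le_powR s1))// NP.
Qed.

Lemma gain_tail_small (eps : R) : 0 < eps ->
  exists N, forall s, (N <= s)%N -> gain_tail s <= eps.
Proof.
move=> e0; have [N NP] := powR_neg_small tail_exponent_lt0 e0.
exists (maxn N 1) => s; rewrite geq_max => /andP[Ns s1].
by rewrite (le_trans (gain_tail_le_powR s1))// NP.
Qed.

(** A discrete Gronwall argument: 1 + y <= exp y, and the exponents telescope through
    [gain_sqr_le]. *)
Lemma gain_bounded_recurrence (q : nat -> R) (K : R) : 0 <= K ->
  (forall s, 0 <= q s) ->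
  (forall s, q s.+1 <= (1 + K * gain s ^+ 2) * q s) ->
  exists M : R, forall s, q s <= M.
Proof.
move=> K0 q0 qS; have [C C0 gC] := gain_sqr_le.
pose E s := expR (K * C * (gain_tail 0 - gain_tail s)).
have qE s : q s <= q 0%N * E s.
  elim: s => [|s IHs]; first by rewrite /E subrr mulr0 expR0 mulr1.
  apply: (le_trans (qS s)).
  have -> : E s.+1 = E s * expR (K * C * (gain_tail s - gain_tail s.+1)).
    by rewrite /E -expRD; congr expR; ring.
  rewrite mulrA [leLHS]mulrC ler_pM//.
    by rewrite addr_ge0// mulr_ge0// sqr_ge0.
  apply: le_trans (expR_ge1Dx _).
  by rewrite lerD2l -mulrA ler_wpM2l.
exists (q 0%N * expR (K * C * gain_tail 0)) => s.
rewrite (le_trans (qE s))// ler_wpM2l// ler_expR ler_wpM2l//.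
  by rewrite mulr_ge0// ltW.
by rewrite gerBl ltW// gain_tail_gt0.
Qed.

Lemma gain_tail_recurrence (q : nat -> nat -> R) (K : R) : 0 <= K ->
  (forall s, q s s = 0) ->
  (forall s t, (s <= t)%N -> q s t.+1 <= q s t + K * gain t ^+ 2) ->
  exists2 M : R, 0 < M & forall s t, (s <= t)%N -> q s t <= M * gain_tail s.
Proof.
move=> K0 qss qS; have [C C0 gC] := gain_sqr_le.
have qE s t : (s <= t)%N -> q s t <= K * C * (gain_tail s - gain_tail t).
  elim: t => [|t IHt]; first by rewrite leqn0 => /eqP->; rewrite qss subrr mulr0.
  rewrite leq_eqVlt => /orP[/eqP->|]; first by rewrite qss subrr mulr0.
  rewrite ltnS => st; rewrite (le_trans (qS _ _ st))//.
  have := IHt st; have : K * gain t ^+ 2 <= K * (C * (gain_tail t - gain_tail t.+1)).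
    by rewrite ler_wpM2l.
  lra.
exists (K * C + 1) => [|s t st]; first by rewrite ltr_wpDl// mulr_ge0// ltW.
rewrite (le_trans (qE s t st))//.
have : 0 <= K * C by rewrite mulr_ge0// ltW.
have := gain_tail_gt0 s; have := gain_tail_gt0 t; nra.
Qed.

(** With g the current gain, (1 - 2 k g) C g + K g^2 <= C g (1 - g) as soon as K <= C and 1 <= k,
    and [gain_step] bounds the right-hand side by C times the next gain. *)
Lemma gain_contraction_recurrence (v : nat -> R) (k K M : R) : 1 <= k -> 0 <= K ->
  (forall s, 0 <= v s <= M) ->
  (forall s, v s.+1 <= (1 - 2 * k * gain s) * v s + K * gain s ^+ 2) ->
  exists2 C : R, 0 < C & forall s, v s <= C * gain s.
Proof.
move=> k1 K0 vM vS.
have [|N N1 NP] := @gain_small (2 * k)^-1; first by rewrite invr_gt0; lra.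
(* [K + 1] serves the induction step; [M / gain N] covers the indices up to [N], before which
   [1 - 2 * k * gain s] may be negative and the induction step fails. *)
pose C := K + 1 + M / gain N.
have M0 : 0 <= M by have /andP[+ _] := vM 0%N; have /andP[_] := vM 0%N; lra.
have MN0 : 0 <= M / gain N by rewrite divr_ge0// ltW// gain_gt0.
have CE : K <= C by rewrite /C; lra.
exists C => [|s]; first by rewrite /C; lra.
have small s' : (s' <= N)%N -> v s' <= C * gain s'.
  move=> sN; have /andP[_ h] := vM s'; apply: (le_trans h).
  apply: le_trans (_ : M / gain N * gain N <= _).
    by rewrite divfK// gt_eqF// gain_gt0.
  rewrite ler_pM ?(ltW (gain_gt0 _)) ?gain_le//.
  by rewrite /C; lra.
elim: s => [|s IHs]; first exact: small.
have [sN|Ns] := leqP s.+1 N; first exact: small.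
rewrite ltnS in Ns; apply: (le_trans (vS s)).
have g0 := gain_gt0 s; have gN := NP _ Ns; have gS := gain_step (leq_trans N1 Ns).
have kg : 2 * k * gain s <= 1.
  by rewrite mulrC -ler_pdivlMr ?mul1r//; lra.
have C0 : 0 <= C by lra.
apply: le_trans (_ : C * (gain s * (1 - gain s)) <= _); last by rewrite ler_wpM2l.
apply: le_trans (_ : (1 - 2 * k * gain s) * (C * gain s) + K * gain s ^+ 2 <= _).
  by rewrite lerD2r ler_wpM2l//; lra.
have : 0 <= (2 * k * C - C - K) * gain s ^+ 2.
  rewrite mulr_ge0 ?sqr_ge0//; have : 0 <= (k - 1) * C by rewrite mulr_ge0//; lra.
  lra.
by rewrite expr2; lra.
Qed.

End GainSequence.

(** * Conditional expectations and square-integrable functions *)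

Section ConditionalMoments.
Context d (T : measurableType d) (R : realType).
Variable mu : {measure set T -> \bar R}.
Import HBNNSimple.

(* Approximating the identity of the real line, rather than [h], by simple
   functions makes only the sets [h @^-1` B] appear. *)
Lemma le_integral_weighted (h Z1 Z2 : T -> R) :
  measurable_fun setT h -> (forall x, 0 <= h x) ->
  measurable_fun setT Z1 -> (forall x, 0 <= Z1 x) ->
  measurable_fun setT Z2 -> (forall x, 0 <= Z2 x) ->
  (forall B : set R, measurable B ->
    \int[mu]_(x in h @^-1` B) (Z1 x)%:E <= \int[mu]_(x in h @^-1` B) (Z2 x)%:E)%E ->
  (\int[mu]_x (h x * Z1 x)%:E <= \int[mu]_x (h x * Z2 x)%:E)%E.
Proof.
move=> mh h0 mZ1 Z10 mZ2 Z20 Z12.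
(* Monotone approximation needs a nonnegative function on the whole line; the absolute value is one,
   and it agrees with the identity on the values of [h]. *)
pose absE : R -> \bar R := fun y => (`|y|)%:E.
have mabs : measurable_fun setT absE.
  by apply/measurable_EFinP; exact: normr_measurable.
pose g := nnsfun_approx measurableT mabs.
have mgh n : measurable_fun setT (g n \o h) by exact: measurableT_comp.
have ghE n x : g n (h x) = \sum_(k \in range (g n)) k * \1_(g n @^-1` [set k]) (h x).
  by rewrite {1}fimfunE.
have cvgZ (Z : T -> R) : measurable_fun setT Z -> (forall x, 0 <= Z x) ->
    (\int[mu]_x (g n (h x) * Z x)%:E)%E @[n --> \oo] -->
    (\int[mu]_x (h x * Z x)%:E)%E.
  move=> mZ Z0.
  have -> : (\int[mu]_x (h x * Z x)%:E =
      \int[mu]_x limn (fun n => (g n (h x) * Z x)%:E))%E.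
    apply: eq_integral => x _; apply/esym/cvg_lim => //.
    under eq_fun do rewrite EFinM; rewrite EFinM; apply: cvgeM => //; last exact: cvg_cst.
    have := @cvg_nnsfun_approx _ _ _ _ measurableT _ mabs (fun y _ => normr_ge0 y) (h x) I.
    by rewrite /absE /= ger0_norm.
  apply: (@cvg_monotone_convergence _ T R mu setT measurableT
    (fun n x => (g n (h x) * Z x)%:E)).
  - by move=> n; apply/measurable_EFinP/measurable_funM => //; exact: mgh.
  - by move=> n x _; rewrite lee_fin mulr_ge0//.
  - move=> x _ m n mn; rewrite lee_fin ler_wpM2r//.
    exact/lefP/nd_nnsfun_approx.
have mA n k : measurable (h @^-1` (g n @^-1` [set k])).
  by rewrite -[X in measurable X]setTI; exact: mh.
(* The coefficient is written [Num.max k 0] to be nonnegative for every real [k], not only for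
   values of [g n]. *)
have intE n (Z : T -> R) : measurable_fun setT Z -> (forall x, 0 <= Z x) ->
    (\int[mu]_x (g n (h x) * Z x)%:E = \sum_(k \in range (g n))
      (Num.max k 0)%:E * \int[mu]_(x in h @^-1` (g n @^-1` [set k])) (Z x)%:E)%E.
  move=> mZ Z0.
  transitivity (\int[mu]_x (\sum_(k \in range (g n))
      (Num.max k 0)%:E * ((Z x)%:E * (\1_(h @^-1` (g n @^-1` [set k])) x)%:E)))%E.
    apply: eq_integral => x _; rewrite ghE EFinM -fsumEFin//.
    rewrite ge0_mule_fsuml; last first.
      by move=> k; rewrite nnfun_muleindic_ge0.
    apply: eq_fsbigr => k /[!inE] -[y _ <-].
    by rewrite max_l// EFinM -muleA [X in (_ * X)%E]muleC.
  rewrite ge0_integral_fsum//; last 2 first.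
  - move=> k; apply: emeasurable_funM => //; apply: emeasurable_funM.
      exact/measurable_EFinP.
    exact/measurable_EFinP/measurable_indic.
  - by move=> k x _; rewrite !mule_ge0 ?lee_fin ?le_max ?lexx ?orbT.
  apply: eq_fsbigr => k _; rewrite ge0_integralZl//; last 3 first.
  - apply: emeasurable_funM; first exact/measurable_EFinP.
    exact/measurable_EFinP/measurable_indic.
  - by move=> x _; rewrite mule_ge0 ?lee_fin.
  - by rewrite lee_fin le_max lexx orbT.
  congr (_ * _)%E; rewrite [RHS]integral_mkcond; apply: eq_integral => x _.
  by rewrite epatch_indic.
apply: (lee_cvg_to (cvgZ _ mZ1 Z10) (cvgZ _ mZ2 Z20)); apply: nearW => n.
rewrite !intE//; apply: lee_fsum => // k _.
by rewrite lee_wpmul2l ?lee_fin ?le_max ?lexx ?orbT// Z12.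
Qed.

End ConditionalMoments.

(** * Weighted integrals of centered functions *)

Section Centered.
Context d (T : measurableType d) (R : realType).
Variable mu : {measure set T -> \bar R}.

Local Notation itg f := (mu.-integrable setT (EFin \o f)).

Lemma itgD (f g : T -> R) : itg f -> itg g -> itg (fun x => f x + g x).
Proof. by move=> If Ig; exact: (integrableD measurableT If Ig). Qed.

Lemma itgZ (k : R) (f : T -> R) : itg f -> itg (fun x => k * f x).
Proof. by move=> If; exact: (integrableZl measurableT k If). Qed.

Lemma itgB (f g : T -> R) : itg f -> itg g -> itg (fun x => f x - g x).
Proof. by move=> If Ig; exact: (integrableB measurableT If Ig). Qed.

Lemma itg_measurable (f : T -> R) : itg f -> measurable_fun setT f.
Proof. by move=> /measurable_int /measurable_EFinP. Qed.

Lemma itg_le (f g : T -> R) : measurable_fun setT f ->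
  (forall x, `|f x| <= `|g x|) -> itg g -> itg f.
Proof.
move=> mf fg; apply: le_integrable => //; first exact/measurable_EFinP.
by move=> x _ /=; rewrite lee_fin.
Qed.

Lemma itg_finite (f : T -> R) (M : \bar R) : measurable_fun setT f ->
  (forall x, 0 <= f x) -> (M < +oo)%E -> (\int[mu]_x (f x)%:E <= M)%E -> itg f.
Proof.
move=> mf f0 Moo fM; apply/integrableP; split; first exact/measurable_EFinP.
apply: le_lt_trans Moo; apply: le_trans fM; rewrite le_eqVlt; apply/orP; left.
by apply/eqP/eq_integral => x _ /=; rewrite ger0_norm.
Qed.

Lemma Rintegral_fineK (f : T -> R) : itg f ->
  (\int[mu]_x (f x)%:E)%E = (\int[mu]_x f x)%:E.
Proof. by move=> If; rewrite /Rintegral fineK//; exact: integrable_fin_num. Qed.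

Definition pospart (f : T -> R) x := Num.max (f x) 0.
Definition negpart (f : T -> R) x := Num.max (- f x) 0.

Lemma pospart_negpart f x : f x = pospart f x - negpart f x.
Proof.
rewrite /pospart /negpart; case: (leP 0 (f x)) => fx.
  by rewrite max_r ?subr0// oppr_le0.
by rewrite max_l ?sub0r ?opprK// oppr_ge0 ltW.
Qed.

Lemma pospart_ge0 f x : 0 <= pospart f x.
Proof. by rewrite /pospart le_max lexx orbT. Qed.

Lemma negpart_ge0 f x : 0 <= negpart f x.
Proof. by rewrite /negpart le_max lexx orbT. Qed.

Lemma pospart_le f x : `|pospart f x| <= `|f x|.
Proof.
by rewrite ger0_norm ?pospart_ge0// /pospart ge_max ler_norm normr_ge0.
Qed.

Lemma negpart_le f x : `|negpart f x| <= `|f x|.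
Proof.
by rewrite ger0_norm ?negpart_ge0// /negpart ge_max -normrN ler_norm normr_ge0.
Qed.

Lemma measurable_pospart f : measurable_fun setT f -> measurable_fun setT (pospart f).
Proof. by move=> mf; exact: measurable_maxr. Qed.

Lemma measurable_negpart f : measurable_fun setT f -> measurable_fun setT (negpart f).
Proof.
move=> mf; apply: measurable_maxr => //.
exact: measurableT_comp.
Qed.

Lemma itg_pospart f : itg f -> itg (pospart f).
Proof.
move=> If; apply: (itg_le _ _ If); last exact: pospart_le.
by apply: measurable_pospart; exact: itg_measurable.
Qed.

Lemma itg_negpart f : itg f -> itg (negpart f).
Proof.
move=> If; apply: (itg_le _ _ If); last exact: negpart_le.
by apply: measurable_negpart; exact: itg_measurable.
Qed.

(** Centering means that the two parts of [Z] have equal integrals on preimages under [h], so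
    [le_integral_weighted] applies in both directions. [phi] will be the positive or the negative
    part of the identity, which treats a signed [h] while testing only its own preimages. *)
Lemma integral_weighted_parts (h Z : T -> R) (phi : R -> R) :
  measurable_fun setT h -> measurable_fun setT phi -> (forall y, 0 <= phi y) ->
  itg Z ->
  (forall B : set R, measurable B -> \int[mu]_(x in h @^-1` B) (Z x)%:E = 0)%E ->
  (\int[mu]_x (phi (h x) * pospart Z x)%:E =
   \int[mu]_x (phi (h x) * negpart Z x)%:E)%E.
Proof.
move=> mh mphi phi0 IZ Z0.
have mB B : measurable B -> measurable (h @^-1` (phi @^-1` B)).
  move=> mB; rewrite -[X in measurable X]setTI; apply: (mh measurableT).
  by rewrite -[X in measurable X]setTI; exact: mphi.
have eqB (B : set R) : measurable B ->
    (\int[mu]_(x in h @^-1` (phi @^-1` B)) (pospart Z x)%:E =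
     \int[mu]_(x in h @^-1` (phi @^-1` B)) (negpart Z x)%:E)%E.
  move=> mB'; have mA := mB _ mB'.
  have IS f : itg f -> mu.-integrable (h @^-1` (phi @^-1` B)) (EFin \o f).
    by move=> If; apply: integrableS If.
  have Ip := IS _ (itg_pospart IZ); have In := IS _ (itg_negpart IZ).
  have := Z0 (phi @^-1` B); rewrite (eq_integral (fun x =>
    (pospart Z x)%:E - (negpart Z x)%:E)%E); last first.
    by move=> x _; rewrite -EFinB -pospart_negpart.
  rewrite integralB_EFin// => H.
  have {}H := H (eq_ind _ measurable (mphi measurableT B mB') _ (setTI _)).
  move: H; have fp := integrable_fin_num mA Ip; have fn := integrable_fin_num mA In.
  rewrite -(fineK fp) -(fineK fn) -EFinB => -[/eqP].
  by rewrite subr_eq0 => /eqP ->.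
have mphih : measurable_fun setT (phi \o h) by exact: measurableT_comp.
have mZ := itg_measurable IZ.
apply/eqP; rewrite eq_le; apply/andP; split;
  apply: (@le_integral_weighted _ T R mu (phi \o h)) => //;
  try exact: measurable_pospart; try exact: measurable_negpart;
  try exact: pospart_ge0; try exact: negpart_ge0; try (by move=> x; exact: phi0);
  by move=> B mB'; rewrite /= comp_preimage eqB.
Qed.

(** Taking out a known factor, with [h] possibly unbounded: integrability of the product passes to
    the four products of parts, which cancel in pairs. *)
Lemma integral_weighted_centered (h Z : T -> R) :
  measurable_fun setT h -> itg Z -> itg (fun x => h x * Z x) ->
  (forall B : set R, measurable B -> \int[mu]_(x in h @^-1` B) (Z x)%:E = 0)%E ->
  \int[mu]_x (h x * Z x) = 0.
Proof.
move=> mh IZ IhZ Z0.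
have mZ := itg_measurable IZ.
have Ipart (p q : (T -> R) -> T -> R) :
    (forall f, measurable_fun setT f -> measurable_fun setT (p f)) ->
    (forall f, measurable_fun setT f -> measurable_fun setT (q f)) ->
    (forall f x, `|p f x| <= `|f x|) -> (forall f x, `|q f x| <= `|f x|) ->
    itg (fun x => p h x * q Z x).
  move=> mp mq pl ql; apply: (itg_le _ _ IhZ); first by apply: measurable_funM; auto.
  by move=> x; rewrite !normrM ler_pM.
have Ipp := Ipart _ _ measurable_pospart measurable_pospart pospart_le pospart_le.
have Ipn := Ipart _ _ measurable_pospart measurable_negpart pospart_le negpart_le.
have Inp := Ipart _ _ measurable_negpart measurable_pospart negpart_le pospart_le.
have Inn := Ipart _ _ measurable_negpart measurable_negpart negpart_le negpart_le.
have mmaxl : measurable_fun setT (fun y : R => Num.max y 0).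
  by apply: measurable_maxr.
have mmaxr : measurable_fun setT (fun y : R => Num.max (- y) 0).
  by apply: measurable_maxr => //; exact: oppr_measurable.
have max0 (y : R) : 0 <= Num.max y 0 by rewrite le_max lexx orbT.
have /(congr1 fine) Hp := integral_weighted_parts mh mmaxl max0 IZ Z0.
have /(congr1 fine) Hn := integral_weighted_parts mh mmaxr (fun y => max0 (- y)) IZ Z0.
rewrite (_ : (fun x => h x * Z x) = (fun x =>
    (pospart h x * pospart Z x - pospart h x * negpart Z x) -
    (negpart h x * pospart Z x - negpart h x * negpart Z x))); last first.
  apply/funext => x; rewrite {1}(pospart_negpart h x) {1}(pospart_negpart Z x).
  by ring.
rewrite RintegralB//; [|exact: itgB|exact: itgB].
by rewrite !RintegralB// [X in (X - _) - _]Hp [X in _ - (X - _)]Hn !subrr.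
Qed.

End Centered.

(** * Conditioning on generated sigma-algebras; square-integrable functions *)

Section ConditionalExpectation.
Context d (T : measurableType d) (R : realType).
Variable Pr : probability T R.

Local Notation itg f := (Pr.-integrable setT (EFin \o f)).

Lemma integral_centered_restrict (f Z : T -> R) (A : set T) :
  measurable_fun setT f -> measurable A -> itg Z -> itg (fun x => f x * Z x) ->
  (forall B : set R, measurable B ->
    \int[Pr]_(x in f @^-1` B `&` A) (Z x)%:E = 0)%E ->
  (\int[Pr]_(x in A) (f x * Z x)%:E = 0)%E.
Proof.
move=> mf mA IZ IfZ Z0; pose Z' := Z \_ A.
have IZ' : itg Z'.
  rewrite -restrict_EFin; apply: (integrable_mkcond _ mA).1.
  by apply: integrableS IZ.
have fZ'E : (fun x => f x * Z' x) = (fun x => f x * Z x) \_ A.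
  by apply/funext => x; rewrite /Z' /patch; case: ifPn; rewrite ?mulr0.
have IfZ' : itg (fun x => f x * Z' x).
  rewrite fZ'E -restrict_EFin; apply: (integrable_mkcond _ mA).1.
  by apply: integrableS IfZ.
have : \int[Pr]_x (f x * Z' x) = 0.
  apply: integral_weighted_centered => // B mB; rewrite -(Z0 B mB) integral_mkcondr.
  by apply: eq_integral => x _; rewrite /Z' !patchE; case: ifPn.
rewrite integral_mkcond (_ : (EFin \o _) \_ A = EFin \o (fun x => f x * Z' x)).
  by move=> h; rewrite [LHS]Rintegral_fineK// h.
by rewrite restrict_EFin fZ'E.
Qed.

(** Two known factors are taken out in turn, the first one under restriction to a preimage under
    [g]. This is the shape of a test function times an entry of (P(s) - P) x(s). *)
Lemma integral_weighted2_centered (f g Z : T -> R) :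
  measurable_fun setT f -> measurable_fun setT g -> itg Z ->
  itg (fun x => f x * Z x) -> itg (fun x => g x * (f x * Z x)) ->
  (forall B C : set R, measurable B -> measurable C ->
    \int[Pr]_(x in f @^-1` B `&` g @^-1` C) (Z x)%:E = 0)%E ->
  \int[Pr]_x (g x * (f x * Z x)) = 0.
Proof.
move=> mf mg IZ IfZ IgfZ Z0; apply: integral_weighted_centered => // C mC.
apply: integral_centered_restrict => // [|B mB]; last exact: Z0.
by rewrite -[X in measurable X]setTI; exact: mg.
Qed.

Lemma sigma_of_preimage (F : set (T -> R)) f (B : set R) :
  F f -> measurable B -> sigma_of F (f @^-1` B).
Proof.
by move=> Ff mB; apply: sub_sigma_algebra; exists f => //; exists B; rewrite ?setTI.
Qed.

Lemma sigma_ofI (F : set (T -> R)) A B :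
  sigma_of F A -> sigma_of F B -> sigma_of F (A `&` B).
Proof.
have /sigma_algebraP[|_ _ _] := smallest_sigma_algebra setT
  (\bigcup_(f in F) preimage_set_system setT f measurable); first by [].
by apply.
Qed.

Lemma sigma_ofT (F : set (T -> R)) : sigma_of F setT.
Proof.
by rewrite -(setD0 setT); apply: sigma_algebraCD; exact: sigma_algebra0.
Qed.

Lemma condexp_cst_centered G (X : T -> R) b A : measurable A -> G A ->
  is_condexp Pr G X (cst b) ->
  itg (fun w => X w - b) /\ (\int[Pr]_(w in A) (X w - b)%:E = 0)%E.
Proof.
move=> mA GA [IX Ib _ Xb]; split; first exact: itgB.
have IS f : itg f -> Pr.-integrable A (EFin \o f) by move=> If; apply: integrableS If.
have Ib' := IS _ Ib; have IX' := IS _ IX.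
rewrite (eq_integral (fun x => (X x)%:E - (cst b x)%:E)%E)//.
rewrite integralB_EFin// -Xb// subee//; exact: integrable_fin_num Ib'.
Qed.

Lemma condexp_cst_weighted (F : set (T -> R)) f (X : T -> R) b :
  F f -> measurable_fun setT f -> is_condexp Pr (sigma_of F) X (cst b) ->
  itg (fun w => f w * (X w - b)) -> \int[Pr]_w (f w * (X w - b)) = 0.
Proof.
move=> Ff mf Xb IfX.
have [IX _] := condexp_cst_centered measurableT (@sigma_ofT F) Xb.
apply: integral_weighted_centered => // B mB.
have := condexp_cst_centered _ (sigma_of_preimage Ff mB) Xb; case=> //.
by rewrite -[X in measurable X]setTI; exact: mf.
Qed.

Lemma condexp_cst_weighted2 (F : set (T -> R)) f g (X : T -> R) b :
  F f -> F g -> measurable_fun setT f -> measurable_fun setT g ->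
  is_condexp Pr (sigma_of F) X (cst b) ->
  itg (fun w => f w * (X w - b)) -> itg (fun w => g w * (f w * (X w - b))) ->
  \int[Pr]_w (g w * (f w * (X w - b))) = 0.
Proof.
move=> Ff Fg mf mg Xb IfX IgfX.
have [IX _] := condexp_cst_centered measurableT (@sigma_ofT F) Xb.
apply: integral_weighted2_centered => // B C mB mC.
have := condexp_cst_centered _ (sigma_ofI (sigma_of_preimage Ff mB)
  (sigma_of_preimage Fg mC)) Xb; case=> //.
by apply: measurableI; rewrite -[X in measurable X]setTI; [exact: mf|exact: mg].
Qed.

Lemma condexp_le_cst G (X Y : T -> R) (M : R) A : measurable A -> G A ->
  is_condexp Pr G X Y -> {ae Pr, forall w, Y w <= M} ->
  (\int[Pr]_(w in A) (X w)%:E <= \int[Pr]_(w in A) M%:E)%E.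
Proof.
move=> mA GA [_ IY _ XY] YM; rewrite -XY//.
have mY := itg_measurable IY.
have IYA : Pr.-integrable A (EFin \o Y) by apply: integrableS IY.
have IMA : Pr.-integrable A (EFin \o cst M).
  exact: finite_measure_integrable_cst.
(* The bound on [Y] holds only almost everywhere; the truncation satisfies it everywhere and has the
   same integral. *)
have mmin : measurable_fun setT (fun w => Num.min (Y w) M).
  by apply: measurable_minr.
have Imin : Pr.-integrable A (EFin \o (fun w => Num.min (Y w) M)).
  apply: integrableS (_ : itg (fun w => Num.min (Y w) M)) => //.
  apply: (itg_le mmin _ (itgD (integrable_norm IY)
    (integrable_norm (finite_measure_integrable_cst Pr M measurableT)))).
  move=> w /=; rewrite [leRHS]ger0_norm ?addr_ge0//.
  by case: (leP (Y w) M) => _; rewrite ?lerDl ?lerDr.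
rewrite (ae_eq_integral (fun w => (Num.min (Y w) M)%:E))//.
- by apply: le_integral => // w _; rewrite lee_fin ge_min lexx orbT.
- exact: measurable_int IYA.
- exact: measurable_int Imin.
- by apply: filterS YM => w YwM _; rewrite min_l.
Qed.

(** Stated with extended integrals because it serves to prove that the left-hand integrand is
    integrable. *)
Lemma condexp_weighted_le (F : set (T -> R)) f (X Y : T -> R) (M : R) :
  F f -> measurable_fun setT f -> (forall w, 0 <= X w) -> 0 <= M ->
  is_condexp Pr (sigma_of F) X Y -> {ae Pr, forall w, Y w <= M} ->
  (\int[Pr]_w (f w ^+ 2 * X w)%:E <= M%:E * \int[Pr]_w (f w ^+ 2)%:E)%E.
Proof.
move=> Ff mf X0 M0 XY YM; have [IX _ _ _] := XY.
have mf2 : measurable_fun setT (fun w => f w ^+ 2) by exact: measurable_funX.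
rewrite -ge0_integralZl_EFin//; last 2 first.
- by move=> x _; rewrite lee_fin sqr_ge0.
- exact/measurable_EFinP.
under [leRHS]eq_integral do rewrite muleC -EFinM.
apply: (@le_integral_weighted _ T R Pr (fun w => f w ^+ 2) X (cst M)) => //.
- by move=> w; exact: sqr_ge0.
- exact: (itg_measurable IX).
move=> B mB; apply: condexp_le_cst XY YM.
  by rewrite -[X in measurable X]setTI; exact: mf2.
rewrite (_ : _ @^-1` B = f @^-1` ((fun y : R => y ^+ 2) @^-1` B)); last by [].
apply: sigma_of_preimage => //; rewrite -[X in measurable X]setTI.
exact: (@measurable_funX _ _ _ setT (@id R) 2 (@measurable_id _ _ _)).
Qed.

Definition sqint (f : T -> R) :=
  measurable_fun setT f /\ itg (fun w => f w ^+ 2).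

Lemma sqint_mul f g : sqint f -> sqint g -> itg (fun w => f w * g w).
Proof.
move=> [mf If] [mg Ig]; apply: (itg_le _ _ (itgD If Ig)).
  exact: measurable_funM.
move=> w; rewrite [leRHS]ger0_norm ?addr_ge0 ?sqr_ge0//.
by apply/ler_normlP; move: (f w) (g w) => a b; split;
  have := sqr_ge0 (a + b); have := sqr_ge0 (a - b);
  have := sqr_ge0 a; have := sqr_ge0 b; nra.
Qed.

Lemma sqintD f g : sqint f -> sqint g -> sqint (fun w => f w + g w).
Proof.
move=> sf sg; have [mf If] := sf; have [mg Ig] := sg.
split; first exact: measurable_funD.
have := itgD (itgD If (itgZ 2 (sqint_mul sf sg))) Ig.
by congr (itg _); apply/funext => w /=; ring.
Qed.

Lemma sqintZ k f : sqint f -> sqint (fun w => k * f w).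
Proof.
move=> [mf If]; split; first exact: measurable_funM.
have := itgZ (k ^+ 2) If.
by congr (itg _); apply/funext => w /=; ring.
Qed.

Lemma sqint_cst k : sqint (cst k).
Proof.
split=> //; exact: (finite_measure_integrable_cst Pr (k ^+ 2) measurableT).
Qed.

Lemma sqint_sum (I : Type) (r : seq I) (f : I -> T -> R) :
  (forall i, sqint (f i)) -> sqint (fun w => \sum_(i <- r) f i w).
Proof.
move=> sf; elim: r => [|i r IH].
  by have := sqint_cst 0; congr sqint; apply/funext => w; rewrite big_nil.
have := sqintD (sf i) IH; congr sqint; apply/funext => w.
by rewrite big_cons.
Qed.

Lemma sqint_itg f : sqint f -> itg f.
Proof.
move=> sf; have := sqint_mul sf (sqint_cst 1).
by congr (itg _); apply/funext => w /=; rewrite mulr1.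
Qed.

Lemma itg_sum (I : Type) (r : seq I) (f : I -> T -> R) :
  (forall i, itg (f i)) -> itg (fun w => \sum_(i <- r) f i w).
Proof.
move=> If; elim: r => [|i r IH].
  have := sqint_itg (sqint_cst 0); congr (itg _); apply/funext => w /=.
  by rewrite big_nil.
have := itgD (If i) IH; congr (itg _); apply/funext => w /=.
by rewrite big_cons.
Qed.

Lemma Rintegral_sum (I : Type) (r : seq I) (f : I -> T -> R) :
  (forall i, itg (f i)) ->
  \int[Pr]_w (\sum_(i <- r) f i w) = \sum_(i <- r) \int[Pr]_w f i w.
Proof.
move=> If; elim: r => [|i r IH].
  rewrite big_nil; under eq_Rintegral do rewrite big_nil.
  by rewrite Rintegral_cst// mul0r.
rewrite big_cons -IH; under eq_Rintegral do rewrite big_cons.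
by rewrite RintegralD//; exact: itg_sum.
Qed.

End ConditionalExpectation.

(** * Convergence of the stochastic recursion *)

Section OperatorNorm.
Context {R : realType}.

(** By normalizing [v]. The Frobenius bound shows that the set defining [opnorm2] is bounded above,
    so that its [sup] is an upper bound. *)
Lemma dotv_le_opnorm2 m n (A : 'M[R]_(m, n)) (v : 'cV[R]_n) :
  dotv (A *m v) (A *m v) <= opnorm2 A ^+ 2 * dotv v v.
Proof.
have [v0|v0] := eqVneq (dotv v v) 0.
  have [K _ AK] := dotv_mulmx_le A.
  by have := AK v; rewrite v0 !mulr0.
have vv_gt0 : 0 < dotv v v by rewrite lt_def v0 dotv_ge0.
have nv_gt0 : 0 < norm2 v.
  rewrite lt_def sqrtr_ge0 andbT; apply: contra v0 => /eqP v0.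
  by rewrite -norm2_sqr v0 expr0n.
pose k := (norm2 v)^-1.
have kk : k * k * dotv v v = 1.
  by rewrite -norm2_sqr expr2 /k mulrACA mulVf ?gt_eqF// mulr1.
have kv : norm2 (k *: v) = 1.
  apply/eqP; rewrite -(eqrXn2 (n := 2))// ?sqrtr_ge0// norm2_sqr expr1n.
  by rewrite dotvZl dotvZr mulrA kk.
have : norm2 (A *m (k *: v)) <= opnorm2 A.
  apply: ub_le_sup; last by exists (k *: v).
  have [K K0 AK] := dotv_mulmx_le A.
  exists (Num.sqrt K) => _ [z /= z1 <-].
  rewrite -(ler_pXn2r (n := 2)) ?nnegrE ?sqrtr_ge0// norm2_sqr sqr_sqrtr//.
  by rewrite (le_trans (AK z))// -norm2_sqr z1 expr1n mulr1.
have A0 : 0 <= norm2 (A *m (k *: v)) by exact: sqrtr_ge0.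
move=> Ak; have : norm2 (A *m (k *: v)) ^+ 2 <= opnorm2 A ^+ 2.
  by rewrite ler_pXn2r ?nnegrE// (le_trans A0).
rewrite norm2_sqr -scalemxAr dotvZl dotvZr mulrA => h.
rewrite -[leLHS]mul1r -kk mulrAC ler_wpM2r// ltW//.
Qed.

Lemma sqr_entry_le_opnorm2 m n (A : 'M[R]_(m, n)) i j :
  A i j ^+ 2 <= opnorm2 A ^+ 2.
Proof.
have := dotv_le_opnorm2 A (delta_mx j 0); have := sqr_le_dotv (A *m delta_mx j 0) i.
rewrite -colE mxE => h1 /(le_trans h1); congr (_ <= _); rewrite /dotv (bigD1 j)//=.
rewrite big1 => [|k kj]; first by rewrite !mxE !eqxx mulr1 addr0 mulr1.
by rewrite mxE (negPf kj) mul0r.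
Qed.

End OperatorNorm.

(** * Square integrability and centering of the noise *)

Section Moments.
Context d (T : measurableType d) (R : realType) (Pr : probability T R) (n : nat).
Variables (Ps : nat -> T -> 'M[R]_n) (us : nat -> T -> 'cV[R]_n).
Variables (P : 'M[R]_n) (u : 'cV[R]_n) (a : nat -> R) (x0 : 'cV[R]_n).
Variable x : nat -> T -> 'cV[R]_n.
Hypothesis mPs : forall s, random_mx (Ps s).
Hypothesis mus : forall s, random_mx (us s).
Hypothesis x_traj : trajectory x a Ps us x0.
Hypothesis xA1 : A1 Pr x Ps us P u.

Local Notation itg f := (Pr.-integrable setT (EFin \o f)).
Local Notation sqint := (sqint Pr).

Definition noise s w := (Ps s w - P) *m x s w + (us s w - u).

Lemma trajectory_noise s w :
  x s.+1 w = x s w + a s *: ((P - 1%:M) *m x s w + u) + a s *: noise s w.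
Proof.
have [_ ->] := x_traj; rewrite /noise scalerBl scale1r !mulmxBl mul1mx.
rewrite -!addrA; congr (_ + _); rewrite -!scalerDr -scalerN -scalerDr.
congr (_ *: _); rewrite [RHS]addrC !addrA; set y := x s w.
apply/matrixP => i j; rewrite !mxE; ring.
Qed.

Lemma A1_uniform : exists2 M : R, 0 <= M & forall s,
  (exists2 Y, is_condexp Pr (sigma_state x s) (fun w => opnorm2 (Ps s w) ^+ 2) Y
            & {ae Pr, forall w, Y w <= M}) /\
  (exists2 Y, is_condexp Pr (sigma_state x s) (fun w => norm2 (us s w) ^+ 2) Y
            & {ae Pr, forall w, Y w <= M}).
Proof.
have [_ _ [M HM]] := xA1; exists (Num.max M 0) => [|s].
  by rewrite le_max lexx orbT.
have [[Y1 H1 Y1M] [Y2 H2 Y2M]] := HM s.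
split; [exists Y1|exists Y2] => //; [apply: filterS Y1M|apply: filterS Y2M] => w;
  by rewrite le_max => ->.
Qed.

Lemma sigma_stateE s i : [set (fun w => x s w j 0) | j in [set: 'I_n]]
  (fun w => x s w i 0).
Proof. by exists i. Qed.

(** [Ps s] need not be independent of the state; the conditional bound in [A1] is what lets the
    weight [x s w j 0 ^+ 2] be taken out. *)
Lemma opnorm2_weighted : exists2 M : R, 0 <= M &
  forall s j, sqint (fun w => x s w j 0) ->
    itg (fun w => x s w j 0 ^+ 2 * opnorm2 (Ps s w) ^+ 2) /\
    \int[Pr]_w (x s w j 0 ^+ 2 * opnorm2 (Ps s w) ^+ 2) <=
      M * \int[Pr]_w (x s w j 0 ^+ 2).
Proof.
have [M M0 HM] := A1_uniform; exists M => // s j [mx Ix].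
have [[Y HY YM] _] := HM s; have [IX _ _ _] := HY.
have h := condexp_weighted_le (sigma_stateE s j) mx (fun w => sqr_ge0 _) M0 HY YM.
have Ixo : itg (fun w => x s w j 0 ^+ 2 * opnorm2 (Ps s w) ^+ 2).
  apply: itg_finite h => //.
  - by apply: measurable_funM (itg_measurable IX); exact: itg_measurable Ix.
  - by move=> w; rewrite mulr_ge0 ?sqr_ge0.
  - by rewrite (Rintegral_fineK Ix) -EFinM ltry.
split=> //; rewrite -lee_fin EFinM -(Rintegral_fineK Ixo).
by rewrite -(Rintegral_fineK Ix).
Qed.

Lemma sqint_Ps_mul s i j : sqint (fun w => x s w j 0) ->
  sqint (fun w => x s w j 0 * Ps s w i j).
Proof.
move=> sx; have [mx Ix] := sx; have [M _ HM] := opnorm2_weighted.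
have [IxP _] := HM s j sx.
have mxP : measurable_fun setT (fun w => x s w j 0 * Ps s w i j).
  by apply: measurable_funM => //; exact: mPs.
split=> //; apply: itg_le IxP; first exact: measurable_funX.
move=> w; rewrite ger0_norm ?sqr_ge0// ger0_norm; last first.
  by apply: mulr_ge0; exact: sqr_ge0.
rewrite exprMn.
by rewrite ler_wpM2l ?sqr_ge0// sqr_entry_le_opnorm2.
Qed.

Lemma sqint_us s i : sqint (fun w => us s w i 0).
Proof.
have [M _ HM] := A1_uniform; have [_ [Y [IX _ _ _] _]] := HM s.
split; first exact: mus.
apply: itg_le IX; first by apply: measurable_funX; exact: mus.
by move=> w; rewrite !ger0_norm ?sqr_ge0// norm2_sqr sqr_le_dotv.
Qed.

Lemma sqint_noise_of s : (forall j, sqint (fun w => x s w j 0)) ->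
  forall i, sqint (fun w => noise s w i 0).
Proof.
move=> sx i.
have -> : (fun w => noise s w i 0) = (fun w =>
    \sum_j (x s w j 0 * Ps s w i j + - P i j * x s w j 0) +
    (us s w i 0 + - u i 0)).
  apply/funext => w; rewrite !mxE; congr (_ + _).
  by apply: eq_bigr => j _; rewrite !mxE; ring.
apply: sqintD; last by apply: sqintD; [exact: sqint_us|exact: sqint_cst].
apply: sqint_sum => j; apply: sqintD; first exact: sqint_Ps_mul.
exact: sqintZ.
Qed.

Lemma sqint_mulmx m (A : 'M[R]_(m, n)) (y : T -> 'cV[R]_n) :
  (forall j, sqint (fun w => y w j 0)) ->
  forall i, sqint (fun w => (A *m y w) i 0).
Proof.
move=> sy i.
have -> : (fun w => (A *m y w) i 0) = (fun w => \sum_j A i j * y w j 0).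
  by apply/funext => w; rewrite mxE.
by apply: sqint_sum => j; exact: sqintZ.
Qed.

(** By induction, since [sqint_noise_of] asks for square integrability of the state at the same time
    only. *)
Lemma sqint_state s j : sqint (fun w => x s w j 0).
Proof.
elim: s j => [|s IH] j.
  have [x0E _] := x_traj.
  rewrite (_ : (fun w => _) = cst (x0 j 0)); first exact: sqint_cst.
  by apply/funext => w; rewrite x0E.
have -> : (fun w => x s.+1 w j 0) = (fun w =>
    x s w j 0 + a s * (((P - 1%:M) *m x s w) j 0 + u j 0) + a s * noise s w j 0).
  by apply/funext => w; rewrite trajectory_noise !mxE.
apply: sqintD; last by apply: sqintZ; exact: sqint_noise_of.
apply: sqintD => //; apply: sqintZ; apply: sqintD; last exact: sqint_cst.
exact: sqint_mulmx.
Qed.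

Lemma sqint_noise s i : sqint (fun w => noise s w i 0).
Proof. by apply: sqint_noise_of => j; exact: sqint_state. Qed.

Lemma itg_dotv m (y z : T -> 'cV[R]_m) :
  (forall j, sqint (fun w => y w j 0)) -> (forall j, sqint (fun w => z w j 0)) ->
  itg (fun w => dotv (y w) (z w)).
Proof. by move=> sy sz; apply: itg_sum => j; exact: sqint_mul. Qed.

(** The noise is multiplicative in the state, so no bound uniform in [s] is available yet;
    [moments_bounded] supplies it later. *)
Lemma noise_second_moment : exists2 C : R, 0 <= C & forall s,
  \int[Pr]_w dotv (noise s w) (noise s w) <=
  C * (1 + \int[Pr]_w dotv (x s w) (x s w)).
Proof.
have [M M0 HM] := A1_uniform; have [M' M'0 HM'] := opnorm2_weighted.
have [K K0 PK] := dotv_mulmx_le P.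
have uu0 := dotv_ge0 u.
exists (4 * (M + M' + K + dotv u u)) => [|s].
  by rewrite mulr_ge0// !addr_ge0.
have [_ [Y HY YM]] := HM s; have [IX _ _ _] := HY.
have Ixx : itg (fun w => dotv (x s w) (x s w)).
  by apply: itg_dotv => j; exact: sqint_state.
have Ix j : itg (fun w => x s w j 0 * x s w j 0).
  by apply: sqint_mul; exact: sqint_state.
have IxPj j := (HM' s j (sqint_state s j)).1.
have xPE : (fun w => opnorm2 (Ps s w) ^+ 2 * dotv (x s w) (x s w)) =
    (fun w => \sum_j x s w j 0 ^+ 2 * opnorm2 (Ps s w) ^+ 2).
  apply/funext => w; rewrite /dotv mulr_sumr; apply: eq_bigr => j _.
  by rewrite expr2 mulrC.
have IxP : itg (fun w => opnorm2 (Ps s w) ^+ 2 * dotv (x s w) (x s w)).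
  by rewrite xPE; apply: itg_sum.
have leP : \int[Pr]_w (opnorm2 (Ps s w) ^+ 2 * dotv (x s w) (x s w)) <=
    M' * \int[Pr]_w dotv (x s w) (x s w).
  rewrite xPE Rintegral_sum// [in leRHS]/dotv [in leRHS]Rintegral_sum//.
  rewrite mulr_sumr; apply: ler_sum => j _.
  have := (HM' s j (sqint_state s j)).2.
  by under [in X in _ <= X]eq_Rintegral do rewrite expr2.
have leu : \int[Pr]_w (norm2 (us s w) ^+ 2) <= M.
  have := condexp_le_cst measurableT (@sigma_ofT _ _ _ _) HY YM.
  rewrite (Rintegral_fineK IX) -lee_fin => /le_trans; apply.
  by rewrite integral_cst//= probability_setT mule1.
(* The 4 comes from two uses of |a + b|^2 <= 2 (|a|^2 + |b|^2): one splits the noise into its two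
   terms, the other splits each difference. *)
pose B w := 4 * (opnorm2 (Ps s w) ^+ 2 * dotv (x s w) (x s w) +
  K * dotv (x s w) (x s w) + norm2 (us s w) ^+ 2 + dotv u u).
have I1 := itgD IxP (itgZ K Ixx).
have I2 := itgD I1 IX.
have Iuu : itg (fun=> dotv u u) by exact: (sqint_itg (sqint_cst _ _)).
have I3 := itgD I2 Iuu.
have IB : itg B by exact: (itgZ 4 I3).
apply: (@le_trans _ _ (\int[Pr]_w B w)).
  apply: le_Rintegral => //.
    by apply: itg_dotv => j; exact: sqint_noise.
  move=> w _; rewrite /noise /B.
  have h1 := dotvD_le ((Ps s w - P) *m x s w) (us s w - u).
  have h2 := dotvD_le (Ps s w *m x s w) (- (P *m x s w)).
  have h3 := dotvD_le (us s w) (- u).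
  have h4 := dotv_le_opnorm2 (Ps s w) (x s w).
  have h5 := PK (x s w).
  rewrite -mulmxBl in h2; rewrite !dotvN in h2 h3.
  rewrite norm2_sqr; lra.
rewrite (RintegralZl 4 measurableT I3) (RintegralD measurableT I2 Iuu).
rewrite (RintegralD measurableT I1 IX) (RintegralD measurableT IxP (itgZ K Ixx)).
rewrite (RintegralZl K measurableT Ixx).
have -> : \int[Pr]_w dotv u u = dotv u u.
  by rewrite (Rintegral_cst Pr measurableT) [X in fine X](probability_setT Pr) mulr1.
have X0 : 0 <= \int[Pr]_w dotv (x s w) (x s w).
  by apply: Rintegral_ge0 => w _; exact: dotv_ge0.
rewrite -mulrA ler_wpM2l//; nra.
Qed.

(** [F] is kept general so as to cover both the current state, as in [A1], and the whole past, as in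
    [history_means]. *)
Lemma noise_centered (F : set (T -> R)) s f i :
  (forall j, F (fun w => x s w j 0)) -> F f -> sqint f ->
  condexp_mx_cst Pr (sigma_of F) (Ps s) P ->
  condexp_mx_cst Pr (sigma_of F) (us s) u ->
  \int[Pr]_w (f w * noise s w i 0) = 0 /\ \int[Pr]_w noise s w i 0 = 0.
Proof.
move=> Fx Ff sf cP cu; have [mf _] := sf.
have sx j := sqint_state s j.
have sxP j : sqint (fun w => x s w j 0 * (Ps s w i j - P i j)).
  have := sqintD (sqint_Ps_mul i (sx j)) (sqintZ (- P i j) (sx j)).
  by congr sqint; apply/funext => w; ring.
have suu : sqint (fun w => us s w i 0 - u i 0).
  by apply: sqintD; [exact: sqint_us|exact: sqint_cst].
have nE w : noise s w i 0 =
    \sum_j x s w j 0 * (Ps s w i j - P i j) + (us s w i 0 - u i 0).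
  rewrite !mxE; congr (_ + _); apply: eq_bigr => j _.
  by rewrite !mxE mulrC.
have mx j : measurable_fun setT (fun w => x s w j 0) by have [] := sx j.
split.
  under eq_Rintegral do rewrite nE mulrDr mulr_sumr.
  rewrite RintegralD//; last 2 first.
  - by apply: itg_sum => j; exact: sqint_mul.
  - exact: sqint_mul.
  rewrite Rintegral_sum; last by move=> j; exact: sqint_mul.
  rewrite big1 => [|j _].
    by rewrite add0r (condexp_cst_weighted Ff mf (cu i 0))//; exact: sqint_mul.
  apply: (condexp_cst_weighted2 (Fx j) Ff (mx j) mf (cP i j)).
    exact: sqint_itg.
  exact: sqint_mul.
under eq_Rintegral do rewrite nE.
rewrite RintegralD//; last 2 first.
- by apply: itg_sum => j; exact: sqint_itg.
- exact: sqint_itg.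
rewrite Rintegral_sum; last by move=> j; exact: sqint_itg.
rewrite big1 => [|j _].
  have [_] := condexp_cst_centered measurableT (@sigma_ofT _ _ _ F) (cu i 0).
  by rewrite add0r /Rintegral => ->.
by apply: (condexp_cst_weighted (Fx j) (mx j) (cP i j)); exact: sqint_itg.
Qed.

End Moments.

(** * Mean square limits of Cauchy sequences *)

Section MeanSquareLimit.
Context d (T : measurableType d) (R : realType) (Pr : probability T R).

Local Notation itg f := (Pr.-integrable setT (EFin \o f)).
Local Notation sqint := (sqint Pr).

Lemma sqintB f g : sqint f -> sqint g -> sqint (fun w => f w - g w).
Proof.
move=> sf sg; have := sqintD sf (sqintZ (-1) sg).
by congr sqint; apply/funext => w; rewrite mulN1r.
Qed.

(** The absolute increments have integrals at most 2^(-j), so their series is integrable and hence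
    finite almost everywhere, where [f] converges by telescoping. *)
Lemma fast_cauchy_ae_cvg (f : nat -> T -> R) :
  (forall j, sqint (f j)) ->
  (forall j, \int[Pr]_w ((f j.+1 w - f j w) ^+ 2) <= (4^-1) ^+ j) ->
  {ae Pr, forall w, cvgn (f ^~ w)}.
Proof.
move=> sf f4; pose h j w := `|f j.+1 w - f j w|.
have h0 j w : 0 <= h j w by rewrite normr_ge0.
have mh j : measurable_fun setT (h j).
  apply: measurableT_comp => //.
  by apply: measurable_funB; [have [] := sf j.+1|have [] := sf j].
have Ih j : (\int[Pr]_w (h j w)%:E <= ((2^-1) ^+ j)%:E)%E.
  have sd := sqintB (sf j.+1) (sf j); have [md Id] := sd.
  (* AM-GM: [|y| <= (2 ^ j y ^ 2 + 2 ^ (- j)) / 2] *)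
  pose b w := 2^-1 * (2 ^+ j * (f j.+1 w - f j w) ^+ 2 + (2^-1) ^+ j).
  have Id' := itgZ (2 ^+ j) Id.
  have Ic : itg (fun=> (2^-1) ^+ j) by exact: (sqint_itg (sqint_cst _ _)).
  have Is := itgD Id' Ic.
  have Ib : itg b by exact: (itgZ 2^-1 Is).
  apply: (@le_trans _ _ (\int[Pr]_w (b w)%:E)%E).
    apply: ge0_le_integral => //.
    - by move=> w _; rewrite lee_fin.
    - exact/measurable_EFinP.
    - exact: measurable_int Ib.
    - move=> w _; rewrite lee_fin /h /b; set y := f j.+1 w - f j w.
      have := sqr_ge0 (2 ^+ j * `|y| - 1).
      have p0 : 0 < 2 ^+ j :> R by rewrite exprn_gt0.
      rewrite sqrrB1 exprMn real_normK ?num_real// => hy.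
      rewrite exprVn -(ler_pM2l p0) mulrCA mulrDr divff ?gt_eqF// mulrA -expr2.
      by rewrite -[X in X <= _](@mulKf _ 2)// ler_pM2l ?invr_gt0//; lra.
  rewrite (Rintegral_fineK Ib) lee_fin (RintegralZl 2^-1 measurableT Is).
  rewrite (RintegralD measurableT Id' Ic) (RintegralZl _ measurableT Id).
  rewrite (Rintegral_cst Pr measurableT) [X in fine X](probability_setT Pr) mulr1.
  have : 2 ^+ j * \int[Pr]_w ((f j.+1 w - f j w) ^+ 2) <= 2^-1 ^+ j.
    rewrite (le_trans (ler_wpM2l _ (f4 j))) ?exprn_ge0// -exprMn.
    by rewrite (_ : 2 * 4^-1 = 2^-1) //; field.
  lra.
have mH : measurable_fun setT (fun w => \sum_(j <oo) (h j w)%:E)%E.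
  apply: ge0_emeasurable_sum => [j w _ _|j _]; first by rewrite lee_fin.
  exact/measurable_EFinP.
have : (\int[Pr]_w (\sum_(j <oo) (h j w)%:E) < +oo)%E.
  rewrite integral_nneseries//; last 2 first.
  - by move=> j; exact/measurable_EFinP.
  - by move=> j w _; rewrite lee_fin.
  apply: (@le_lt_trans _ _ 2%:E); last exact: ltry.
  apply: lime_le; first by apply: is_cvg_nneseries => j _ _; apply: integral_ge0 => w _;
    rewrite lee_fin.
  apply: nearW => N; apply: (@le_trans _ _ (\sum_(0 <= j < N) ((2^-1) ^+ j)%:E)%E).
    by apply: lee_sum => j _; exact: Ih.
  rewrite sumEFin lee_fin.
  suff -> : \sum_(0 <= j < N) 2^-1 ^+ j = 2 - 2 * 2^-1 ^+ N :> R.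
    by rewrite gerBl mulr_ge0// exprn_ge0.
  elim: N => [|N IH]; first by rewrite big_geq// expr0; lra.
  by rewrite big_nat_recr//= IH exprS mulrA; lra.
move=> Hfin; have IH : Pr.-integrable setT (fun w => \sum_(j <oo) (h j w)%:E)%E.
  apply/integrableP; split => //; apply: le_lt_trans Hfin.
  rewrite le_eqVlt; apply/orP; left; apply/eqP/eq_integral => w _.
  by rewrite gee0_abs// nneseries_ge0// => j _ _; rewrite lee_fin.
have := integrable_ae measurableT IH; apply: filterS => w /(_ I) Hw.
have : cvgn (series (telescope (f ^~ w))).
  apply: normed_cvg; apply: nondecreasing_is_cvgn.
    apply/nondecreasing_seqP => N; rewrite /= /series/= big_nat_recr//=.
    by rewrite lerDl.
  exists (fine (\sum_(j <oo) (h j w)%:E)%E) => _ [N _ <-].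
  rewrite -lee_fin fineK//= /series/= -sumEFin.
  by apply: nneseries_lim_ge => j _ _; rewrite lee_fin.
rewrite telescopeK => cv.
have -> : f ^~ w = (fun j => (f j w - f 0%N w) + f 0%N w).
  by apply/funext => j; rewrite subrK.
by apply: is_cvgD => //; exact: is_cvg_cst.
Qed.

(* Along a subsequence with summable increments [f] converges almost surely,
   and Fatou's lemma transfers the Cauchy bound to the limit. *)
Lemma mean_square_limit (f : nat -> T -> R) (eps : nat -> R) :
  (forall s, sqint (f s)) ->
  (forall s t, (s <= t)%N -> \int[Pr]_w ((f t w - f s w) ^+ 2) <= eps s) ->
  (forall e, 0 < e -> exists N, forall s, (N <= s)%N -> eps s <= e) ->
  exists2 g, sqint g & forall s, \int[Pr]_w ((f s w - g w) ^+ 2) <= eps s.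
Proof.
move=> sf feps eps0.
have /choice[N HN] : forall j, exists N, forall s, (N <= s)%N -> eps s <= (4^-1) ^+ j.
  by move=> j; apply: eps0; rewrite exprn_gt0.
(* The sum of successors makes [k] increasing, with both [j <= k j] and [N j <= k j]. *)
pose k j := \sum_(i < j.+1) (N i).+1.
have kS j : k j.+1 = (k j + (N j.+1).+1)%N by rewrite /k big_ord_recr.
have k_ge j : (j <= k j)%N.
  by elim: j => [//|j IH]; rewrite kS addnS ltnS (leq_trans IH)// leq_addr.
have Nk j : (N j <= k j)%N.
  by rewrite /k big_ord_recr/= (leq_trans (leqnSn _))// leq_addl.
have cv : {ae Pr, forall w, cvgn (fun j => f (k j) w)}.
  apply: (@fast_cauchy_ae_cvg (fun j => f (k j))) => // j.
  by rewrite (le_trans (feps _ _ _))// ?HN// kS leq_addr.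
have mf s : measurable_fun setT (f s) by have [] := sf s.
(* An upper limit is defined and measurable everywhere, and it is the limit wherever the subsequence
   converges; no null set has to be removed. *)
pose g w := fine (limn_esup (fun j => (f (k j) w)%:E)).
have mg : measurable_fun setT g.
  apply: measurableT_comp => //; apply: measurable_fun_limn_esup => j.
  exact/measurable_EFinP.
have gE w : cvgn (fun j => f (k j) w) -> (fun j => f (k j) w) @ \oo --> g w.
  move=> cw; have /(cvg_comp _ _ cw) /cvg_limn_einf_sup[_ E] :
    EFin @ limn (fun j => f (k j) w) --> (limn (fun j => f (k j) w))%:E by [].
  by rewrite /g [limn_esup _]E.
have fatou_s s : (\int[Pr]_w ((f s w - g w) ^+ 2)%:E <= (eps s)%:E)%E.
  have mfk j : measurable_fun setT (fun w => ((f s w - f (k j) w) ^+ 2)%:E).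
    by apply/measurable_EFinP; apply: measurable_funX; exact: measurable_funB.
  have fk0 j w : setT w -> (0 <= ((f s w - f (k j) w) ^+ 2)%:E)%E.
    by rewrite lee_fin sqr_ge0.
  have -> : (\int[Pr]_w ((f s w - g w) ^+ 2)%:E =
      \int[Pr]_w limn_einf (fun j => ((f s w - f (k j) w) ^+ 2)%:E))%E.
    apply: ae_eq_integral => //.
    - by apply/measurable_EFinP; apply: measurable_funX; exact: measurable_funB.
    - rewrite (_ : (fun w => _) = (fun w =>
          - limn_esup (fun j => - ((f s w - f (k j) w) ^+ 2)%:E))%E); last first.
        by apply/funext => w; rewrite -limn_einfN; congr limn_einf;
          apply/funext => j /=; rewrite opprK.
      apply: measurableT_comp => //; apply: measurable_fun_limn_esup => j.
      by apply: measurableT_comp => //; exact: mfk.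
    apply: filterS cv => w cw _; apply/esym.
    suff /cvg_limn_einf_sup[-> _] : (fun j => ((f s w - f (k j) w) ^+ 2)%:E) @ \oo -->
      ((f s w - g w) ^+ 2)%:E by [].
    apply: cvg_EFin; first by apply: nearW.
    rewrite expr2; under eq_fun do rewrite /= expr2.
    by apply: cvgM; apply: cvgB; (try exact: cvg_cst); exact: gE.
  apply: le_trans (fatou _ measurableT mfk fk0) _.
  rewrite limn_einf_lim; apply: lime_le; first exact: is_cvg_einfs.
  apply: nearW => j.
  (* The infimum over the tail from [j] is at most its member of index [maxn j s], which is late
     enough for the Cauchy bound from [s]. *)
  apply: (@le_trans _ _ (\int[Pr]_w ((f s w - f (k (maxn j s)) w) ^+ 2)%:E)%E).
    by apply: ereal_inf_lbound; exists (maxn j s) => //=; rewrite leq_maxl.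
  have sks : (s <= k (maxn j s))%N by rewrite (leq_trans _ (k_ge _))// leq_maxr.
  have [_ Id] := sqintB (sf s) (sf (k (maxn j s))).
  rewrite (Rintegral_fineK Id) lee_fin (le_trans _ (feps _ _ sks))//.
  by under eq_Rintegral do rewrite -sqrrN opprB.
have Ifg s : itg (fun w => (f s w - g w) ^+ 2).
  apply: itg_finite (fatou_s s) => //; last exact: ltry.
  - by apply: measurable_funX; exact: measurable_funB.
  - by move=> w; exact: sqr_ge0.
exists g => [|s]; last by rewrite -lee_fin -(Rintegral_fineK (Ifg s)).
have sfg : sqint (fun w => f 0%N w - g w).
  by split => //; exact: measurable_funB.
have := sqintB (sf 0%N) sfg; congr sqint; apply/funext => w.
by rewrite opprB addrCA subrr addr0.
Qed.

End MeanSquareLimit.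

(** * Moment recurrences, the decaying error and the martingale component *)

Section StochasticApproximation.
Context d (T : measurableType d) (R : realType) (Pr : probability T R) (n : nat).
Variables (Ps : nat -> T -> 'M[R]_n) (us : nat -> T -> 'cV[R]_n).
Variables (P : 'M[R]_n) (u : 'cV[R]_n) (a : nat -> R) (x0 : 'cV[R]_n).
Variable x : nat -> T -> 'cV[R]_n.
Hypothesis mPs : forall s, random_mx (Ps s).
Hypothesis mus : forall s, random_mx (us s).
Hypothesis x_traj : trajectory x a Ps us x0.
Hypothesis xA1 : A1 Pr x Ps us P u.

Local Notation itg f := (Pr.-integrable setT (EFin \o f)).
Local Notation sqint := (sqint Pr).
Local Notation N := (noise Ps us P u x).

Lemma sqint_vecD m (y z : T -> 'cV[R]_m) :
  (forall j, sqint (fun w => y w j 0)) -> (forall j, sqint (fun w => z w j 0)) ->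
  forall j, sqint (fun w => (y w + z w) j 0).
Proof.
move=> sy sz j; have := sqintD (sy j) (sz j).
by congr sqint; apply/funext => w; rewrite mxE.
Qed.

Lemma sqint_vecZ m k (y : T -> 'cV[R]_m) :
  (forall j, sqint (fun w => y w j 0)) -> forall j, sqint (fun w => (k *: y w) j 0).
Proof.
move=> sy j; have := sqintZ k (sy j).
by congr sqint; apply/funext => w; rewrite mxE.
Qed.

Lemma sqint_vec_cst m (c : 'cV[R]_m) j : sqint (fun=> c j 0).
Proof. exact: sqint_cst. Qed.

Lemma integral_dotvD m (y z : T -> 'cV[R]_m) k :
  (forall j, sqint (fun w => y w j 0)) -> (forall j, sqint (fun w => z w j 0)) ->
  \int[Pr]_w dotv (y w) (z w) = 0 ->
  \int[Pr]_w dotv (y w + k *: z w) (y w + k *: z w) =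
  \int[Pr]_w dotv (y w) (y w) + k ^+ 2 * \int[Pr]_w dotv (z w) (z w).
Proof.
move=> sy sz yz0.
have Iyy := itg_dotv sy sy; have Iyz := itg_dotv sy sz; have Izz := itg_dotv sz sz.
have -> : (fun w => dotv (y w + k *: z w) (y w + k *: z w)) =
    (fun w => (dotv (y w) (y w) + 2 * k * dotv (y w) (z w)) +
              k ^+ 2 * dotv (z w) (z w)).
  apply/funext => w; rewrite dotvDl !dotvDr !(dotvZl, dotvZr) (dotvC (z w) (y w)).
  by ring.
rewrite (RintegralD measurableT (itgD Iyy (itgZ _ Iyz)) (itgZ _ Izz)).
rewrite (RintegralD measurableT Iyy (itgZ _ Iyz)) !RintegralZl//.
by rewrite yz0 mulr0 addr0.
Qed.

(** The orthogonality that conditioning on the current state provides; it removes the cross terms of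
    both one-step recurrences. *)
Lemma integral_affine_noise s m (A M : 'M[R]_(m, n)) (c : 'cV[R]_m) :
  \int[Pr]_w dotv (A *m x s w + c) (M *m N s w) = 0.
Proof.
have [cP cu _] := xA1.
pose C := M^T *m A; pose c' := M^T *m c.
have sx j := sqint_state mPs mus x_traj xA1 s j.
have sN i := sqint_noise mPs mus x_traj xA1 s i.
have -> : (fun w => dotv (A *m x s w + c) (M *m N s w)) =
    (fun w => \sum_i (\sum_j C i j * (x s w j 0 * N s w i 0) + c' i 0 * N s w i 0)).
  apply/funext => w; rewrite dotv_mulmxr mulmxDr mulmxA -/C -/c'.
  apply: eq_bigr => i _; rewrite mxE mulrDl; congr (_ + _).
  by rewrite mxE mulr_suml; apply: eq_bigr => j _; rewrite mulrA.
have IxN i j : itg (fun w => C i j * (x s w j 0 * N s w i 0)).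
  by apply: itgZ; exact: sqint_mul.
have ISum i : itg (fun w => \sum_j C i j * (x s w j 0 * N s w i 0)).
  exact: itg_sum.
have IN i : itg (fun w => c' i 0 * N s w i 0) by apply: itgZ; exact: sqint_itg.
rewrite Rintegral_sum; last by move=> i; exact: itgD.
apply: big1 => i _; rewrite (RintegralD measurableT (ISum i) (IN i)).
have cent j := noise_centered mPs mus x_traj xA1 i (sigma_stateE x s)
  (sigma_stateE x s j) (sx j) (cP s) (cu s).
rewrite Rintegral_sum// big1 => [|j _]; last first.
  rewrite RintegralZl//; last exact: sqint_mul.
  by rewrite (cent j).1 mulr0.
rewrite add0r RintegralZl//; last exact: sqint_itg.
by rewrite (cent i).2 mulr0.
Qed.

Variables (k alpha beta gamma : R).
Hypothesis kk : k * k = 1.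
Hypothesis alpha_gt0 : 0 < alpha.
Hypotheses (beta_gt0 : 0 < beta) (gamma_gt : 1 < 2 * gamma).
Hypothesis gamma_le1 : gamma <= 1.
Hypothesis aE : forall s, a s = k * (alpha * gain beta gamma s).

Let B := k *: (P - 1%:M).
Variables (Q : 'M[R]_n) (x_inf : 'cV[R]_n).
Hypotheses (QQ : Q *m Q = Q) (QB : Q *m B = 0) (BQ : B *m Q = 0).
Hypotheses (Qu : Q *m u = 0) (Qx_inf : Q *m x_inf = 0).
Hypothesis Bx_inf : B *m x_inf = - (k *: u).

Variables (l : nat) (L : 'M[R]_(l, n)) (c K : R).
Hypotheses (c_gt0 : 0 < c) (K_ge0 : 0 <= K) (alpha_c : 1 <= c * alpha).
Hypothesis L_lyapunov : forall v,
  dotv (L *m v) (L *m ((B - Q) *m v)) <= - c * dotv (L *m v) (L *m v).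
Hypothesis L_bound : forall v, dotv v v <= K * dotv (L *m v) (L *m v).

Let b s := alpha * gain beta gamma s.
Let b_gt0 s : 0 < b s.
Proof. by rewrite mulr_gt0// gain_gt0. Qed.

Lemma state_step s w :
  x s.+1 w = x s w + b s *: (B *m x s w + k *: u) + (b s * k) *: N s w.
Proof.
rewrite (trajectory_noise P u x_traj) aE -/(b s) mulrC; congr (_ + _ + _).
by rewrite -scalerA scalerDr scalemxAl.
Qed.

Lemma projected_step s w :
  Q *m x s.+1 w = Q *m x s w + (b s * k) *: (Q *m N s w).
Proof.
have Q0 : Q *m (b s *: (B *m x s w + k *: u)) = 0.
  rewrite -scalemxAr mulmxDr (mulmxA Q B) QB mul0mx add0r.
  by rewrite -(scalemxAr k) Qu !scaler0.
by rewrite state_step mulmxDr mulmxDr Q0 addr0 -scalemxAr.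
Qed.

Definition error s w := x s w - Q *m x s w - x_inf.

(** On such vectors [B] and [B - Q] agree, so the Lyapunov inequality for [B - Q] applies to the
    drift [B *m error s w]. *)
Lemma Q_error s w : Q *m error s w = 0.
Proof. by rewrite /error !mulmxBr mulmxA QQ Qx_inf subrr subr0. Qed.

Lemma error_step s w : error s.+1 w =
  error s w + b s *: (B *m error s w) + (b s * k) *: ((1%:M - Q) *m N s w).
Proof.
have BE : B *m error s w = B *m x s w + k *: u.
  by rewrite /error !mulmxBr mulmxA BQ mul0mx subr0 Bx_inf opprK.
rewrite BE mulmxBl mul1mx /error projected_step state_step.
rewrite [(b s * k) *: (_ - _)]scalerBr.
by apply/matrixP => i j; rewrite !mxE; ring.
Qed.

Lemma error_affine s w : error s w = (1%:M - Q) *m x s w + - x_inf.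
Proof. by rewrite mulmxBl mul1mx. Qed.

Lemma sqint_error s j : sqint (fun w => error s w j 0).
Proof.
have -> : (fun w => error s w j 0) = (fun w => ((1%:M - Q) *m x s w + - x_inf) j 0).
  by apply/funext => w; rewrite error_affine.
move: j; apply: sqint_vecD; last exact: sqint_vec_cst.
by apply: sqint_mulmx => j; exact: (sqint_state mPs mus x_traj xA1).
Qed.

Lemma sqint_projected s j : sqint (fun w => (Q *m x s w) j 0).
Proof. by move: j; apply: sqint_mulmx => j; exact: (sqint_state mPs mus x_traj xA1). Qed.

Let v s := \int[Pr]_w dotv (L *m error s w) (L *m error s w).
Let p s := \int[Pr]_w dotv (Q *m x s w) (Q *m x s w).

Let v_ge0 s : 0 <= v s.
Proof. by apply: Rintegral_ge0 => w _; exact: dotv_ge0. Qed.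

Let p_ge0 s : 0 <= p s.
Proof. by apply: Rintegral_ge0 => w _; exact: dotv_ge0. Qed.

Let sLe s j : sqint (fun w => (L *m error s w) j 0).
Proof. by move: j; apply: sqint_mulmx => j; exact: sqint_error. Qed.

Let ILe s : itg (fun w => dotv (L *m error s w) (L *m error s w)).
Proof. by apply: itg_dotv => j; exact: sLe. Qed.

Let IQx s : itg (fun w => dotv (Q *m x s w) (Q *m x s w)).
Proof. by apply: itg_dotv => j; exact: sqint_projected. Qed.

Let sN s j : sqint (fun w => N s w j 0).
Proof. exact: (sqint_noise mPs mus x_traj xA1). Qed.

Lemma noise_moment_error : exists2 C, 0 <= C & forall s,
  \int[Pr]_w dotv (N s w) (N s w) <= C * (1 + p s + v s).
Proof.
have [C C0 HC] := noise_second_moment mPs mus x_traj xA1.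
pose k0 := dotv x_inf x_inf; have k00 : 0 <= k0 by exact: dotv_ge0.
(* From |x|^2 <= 2 |Q x|^2 + 4 |e|^2 + 4 |x_inf|^2, with e the error, and the coercivity constant
   [K]. *)
exists (C * (1 + 2 + 4 * K + 4 * k0)) => [|s].
  by rewrite mulr_ge0// !addr_ge0// mulr_ge0.
apply: (le_trans (HC s)); rewrite -mulrA ler_wpM2l//.
have Ixx : itg (fun w => dotv (x s w) (x s w)).
  by apply: itg_dotv => j; exact: (sqint_state mPs mus x_traj xA1).
have Ik : itg (fun=> 4 * k0) by exact: (sqint_itg (sqint_cst _ _)).
have I1 := itgD (itgZ 2 (IQx s)) (itgZ (4 * K) (ILe s)).
have I2 := itgD I1 Ik.
have : \int[Pr]_w dotv (x s w) (x s w) <= 2 * p s + 4 * K * v s + 4 * k0.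
  have -> : 2 * p s + 4 * K * v s + 4 * k0 = \int[Pr]_w
      (2 * dotv (Q *m x s w) (Q *m x s w) +
       4 * K * dotv (L *m error s w) (L *m error s w) + 4 * k0).
    rewrite (RintegralD measurableT I1 Ik).
    rewrite (RintegralD measurableT (itgZ 2 (IQx s)) (itgZ (4 * K) (ILe s))).
    rewrite (RintegralZl _ measurableT (IQx s)) (RintegralZl _ measurableT (ILe s)).
    rewrite (Rintegral_cst Pr measurableT) [X in fine X](probability_setT Pr).
    by rewrite mulr1.
  apply: le_Rintegral => // w _.
  have xE : x s w = Q *m x s w + (error s w + x_inf) by rewrite /error !subrK addrC subrK.
  have h1 := dotvD_le (Q *m x s w) (error s w + x_inf); rewrite -xE in h1.
  have h2 := dotvD_le (error s w) x_inf.
  have h3 := L_bound (error s w).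
  rewrite -/k0 in h2; lra.
have := p_ge0 s; have := v_ge0 s => v0 p0.
have : 0 <= K * v s by rewrite mulr_ge0.
have : 0 <= k0 * (p s + v s) by rewrite mulr_ge0// addr_ge0.
have : 0 <= K * (1 + p s) by rewrite mulr_ge0// addr_ge0.
nra.
Qed.

Lemma noise_image_moment m (A : 'M[R]_(m, n)) : exists2 C, 0 <= C & forall s,
  \int[Pr]_w dotv (A *m N s w) (A *m N s w) <= C * (1 + p s + v s).
Proof.
have [C C0 HC] := noise_moment_error; have [K1 K10 HK1] := dotv_mulmx_le A.
exists (K1 * C) => [|s]; first by rewrite mulr_ge0.
have INN : itg (fun w => dotv (N s w) (N s w)) by apply: itg_dotv => j; exact: sN.
rewrite -mulrA (le_trans _ (ler_wpM2l K10 (HC s)))//.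
rewrite -(RintegralZl _ measurableT INN); apply: le_Rintegral => //.
- by apply: itg_dotv => j; move: j; apply: sqint_mulmx => j; exact: sN.
- exact: itgZ.
Qed.

Let bk2 s : (b s * k) ^+ 2 = alpha ^+ 2 * gain beta gamma s ^+ 2.
Proof. by rewrite /b !exprMn [k ^+ 2]expr2 kk mulr1. Qed.

Lemma projected_recurrence : exists2 C, 0 <= C & forall s,
  p s.+1 <= p s + C * gain beta gamma s ^+ 2 * (1 + p s + v s).
Proof.
have [C C0 HC] := noise_image_moment Q.
exists (alpha ^+ 2 * C) => [|s]; first by rewrite mulr_ge0 ?sqr_ge0.
have sQN j : sqint (fun w => (Q *m N s w) j 0) by move: j; apply: sqint_mulmx.
rewrite {1}/p; under eq_Rintegral do rewrite projected_step.
rewrite integral_dotvD//; last 2 first.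
- exact: sqint_projected.
- by have := integral_affine_noise s Q Q 0; under eq_Rintegral do rewrite addr0.
rewrite lerD2l bk2.
rewrite [leRHS](_ : _ = alpha ^+ 2 * gain beta gamma s ^+ 2 * (C * (1 + p s + v s))).
  by rewrite ler_wpM2l// mulr_ge0 ?sqr_ge0.
by ring.
Qed.

Lemma error_recurrence : exists2 C, 0 <= C & forall s,
  v s.+1 <= (1 - 2 * (c * alpha) * gain beta gamma s) * v s +
            C * gain beta gamma s ^+ 2 * (1 + p s + v s).
Proof.
have [C C0 HC] := noise_image_moment (L *m (1%:M - Q)).
have [K1 K10 HK1] := dotv_mulmx_le (L *m B).
exists (alpha ^+ 2 * (K1 * K + C)) => [|s].
  by rewrite mulr_ge0 ?sqr_ge0// addr_ge0// mulr_ge0.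
set g := gain beta gamma s.
(* The part of the next error determined by [x s]: it is affine in the state, hence orthogonal to
   the noise. *)
pose y w := L *m error s w + b s *: (L *m B *m error s w).
have sy j : sqint (fun w => y w j 0).
  move: j; apply: sqint_vecD; first exact: sLe.
  by apply: sqint_vecZ; apply: sqint_mulmx => j; exact: sqint_error.
have sz j : sqint (fun w => (L *m (1%:M - Q) *m N s w) j 0).
  by move: j; apply: sqint_mulmx.
rewrite {1}/v.
have -> : (fun w => dotv (L *m error s.+1 w) (L *m error s.+1 w)) =
    (fun w => dotv (y w + (b s * k) *: (L *m (1%:M - Q) *m N s w))
                   (y w + (b s * k) *: (L *m (1%:M - Q) *m N s w))).
  apply/funext => w; rewrite (_ : L *m error s.+1 w =
    y w + (b s * k) *: (L *m (1%:M - Q) *m N s w))// error_step /y.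
  move: (error s w) (N s w) => e N0.
  rewrite (mulmxDr L (e + _)) (mulmxDr L e) -(scalemxAr (b s)) -(scalemxAr (_ * k)).
  by rewrite (mulmxA L B) (mulmxA L (1%:M - Q)).
rewrite integral_dotvD//; last first.
  pose A := L + b s *: (L *m B).
  have := integral_affine_noise s (A *m (1%:M - Q)) (L *m (1%:M - Q)) (- (A *m x_inf)).
  congr (_ = _); apply: eq_Rintegral => w _; congr dotv.
  rewrite /y scalemxAl -mulmxDl -/A error_affine.
  by rewrite (mulmxDr A (_ *m x s w)) mulmxN (mulmxA A).
rewrite bk2 -/g.
have Iyy : itg (fun w => dotv (y w) (y w)) by apply: itg_dotv.
have hy : \int[Pr]_w dotv (y w) (y w) <=
    (1 - 2 * (c * alpha) * g + alpha ^+ 2 * (K1 * K) * g ^+ 2) * v s.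
  rewrite -(RintegralZl _ measurableT (ILe s)); apply: le_Rintegral => //.
    exact: itgZ.
  move=> w _; rewrite /y dotvDl !dotvDr !(dotvZl, dotvZr).
  rewrite (dotvC (L *m B *m _)) -mulmxA.
  have := L_lyapunov (error s w); rewrite mulmxBl Q_error subr0.
  have := HK1 (error s w); rewrite -mulmxA.
  have := L_bound (error s w).
  set V := dotv (L *m error s w) (L *m error s w).
  set X := dotv (L *m error s w) _; set Y := dotv (L *m (B *m _)) _ => h1 h2 h3.
  have hY : Y <= K1 * K * V.
    by rewrite (le_trans h2)// -mulrA ler_wpM2l.
  have h4 : b s * X <= b s * (- c * V) by rewrite ler_wpM2l// ltW.
  have h5 : b s * b s * Y <= b s * b s * (K1 * K * V).
    by rewrite ler_wpM2l// mulr_ge0// ltW.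
  rewrite /b -/g in h4 h5 *; lra.
have hz : alpha ^+ 2 * g ^+ 2 * (\int[Pr]_w dotv (L *m (1%:M - Q) *m N s w)
    (L *m (1%:M - Q) *m N s w)) <= alpha ^+ 2 * g ^+ 2 * (C * (1 + p s + v s)).
  by rewrite ler_wpM2l// mulr_ge0 ?sqr_ge0.
apply: (le_trans (lerD hy hz)); rewrite -subr_ge0.
rewrite (_ : _ - _ = alpha ^+ 2 * (K1 * K) * g ^+ 2 * (1 + p s)); last by ring.
apply: mulr_ge0; last by rewrite addr_ge0.
by apply: mulr_ge0; rewrite ?sqr_ge0// mulr_ge0 ?sqr_ge0// mulr_ge0.
Qed.

(** Each recurrence involves both moments, so only their sum satisfies a closed inequality. The
    contraction of [v] is dropped here; the summability of squared gains suffices. *)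
Lemma moments_bounded : exists M, forall s, 1 + p s + v s <= M.
Proof.
have [C1 C10 H1] := projected_recurrence; have [C2 C20 H2] := error_recurrence.
apply: (@gain_bounded_recurrence _ beta gamma beta_gt0 gamma_gt _ (C1 + C2)).
- exact: addr_ge0.
- by move=> s; rewrite !addr_ge0.
move=> s; apply: (le_trans (lerD (lerD (lexx 1) (H1 s)) (H2 s))).
rewrite -subr_ge0 (_ : _ - _ = 2 * (c * alpha) * gain beta gamma s * v s).
  by rewrite !mulr_ge0// ltW// gain_gt0.
by ring.
Qed.

Lemma error_rate : exists2 C : R, 0 < C & forall s,
  \int[Pr]_w dotv (error s w) (error s w) <= C * gain beta gamma s.
Proof.
have [M HM] := moments_bounded; have [C C0 HC] := error_recurrence.
have [|||D D0 HD] := @gain_contraction_recurrence _ beta gamma beta_gt0 gamma_gt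
  gamma_le1 v (c * alpha) (C * M) M alpha_c.
- by rewrite mulr_ge0//; have := HM 0%N; have := p_ge0 0; have := v_ge0 0; lra.
- by move=> s; rewrite v_ge0/=; have := HM s; have := p_ge0 s; lra.
- move=> s; rewrite (le_trans (HC s))// lerD2l [leRHS]mulrAC.
  by rewrite ler_wpM2l// mulr_ge0 ?sqr_ge0.
exists ((K + 1) * D) => [|s]; first by rewrite mulr_gt0// ltr_wpDl.
apply: (@le_trans _ _ (K * v s)).
  rewrite -(RintegralZl _ measurableT (ILe s)); apply: le_Rintegral => //.
  - by apply: itg_dotv => j; exact: sqint_error.
  - exact: itgZ.
have Dg := HD s; have Dg0 := le_trans (v_ge0 s) Dg.
by rewrite -mulrA (le_trans (ler_wpM2l K_ge0 Dg))// ler_wpM2r// lerDl.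
Qed.

Let sQN s j : sqint (fun w => (Q *m N s w) j 0).
Proof. by move: j; apply: sqint_mulmx => j; exact: sN. Qed.

Lemma history_mem s t i : (s <= t)%N ->
  [set f | exists k i, (k <= t)%N /\ f = (fun w => x k w i 0)] (fun w => x s w i 0).
Proof. by move=> st; exists s, i. Qed.

(** An earlier state need not be a function of [x t], so here the conditioning is on the whole
    past. *)
Lemma projected_noise_cross s t : history_means Pr x Ps us P u -> (s <= t)%N ->
  \int[Pr]_w dotv (Q *m x s w) (Q *m N t w) = 0.
Proof.
move=> [hP hu] st; pose C := Q^T *m Q.
have sx r j := sqint_state mPs mus x_traj xA1 r j.
have -> : (fun w => dotv (Q *m x s w) (Q *m N t w)) =
    (fun w => \sum_i \sum_j C i j * (x s w j 0 * N t w i 0)).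
  apply/funext => w; rewrite dotv_mulmxr mulmxA -/C.
  apply: eq_bigr => i _; rewrite mxE mulr_suml.
  by apply: eq_bigr => j _; rewrite mulrA.
have IxN i j : itg (fun w => C i j * (x s w j 0 * N t w i 0)).
  by apply: itgZ; exact: sqint_mul.
rewrite Rintegral_sum; last by move=> i; exact: itg_sum.
apply: big1 => i _; rewrite Rintegral_sum//; apply: big1 => j _.
rewrite RintegralZl//; last exact: sqint_mul.
have [-> _] := noise_centered mPs mus x_traj xA1 i
  (fun j => history_mem j (leqnn t)) (history_mem j st) (sx s j) (hP t) (hu t).
by rewrite mulr0.
Qed.

Lemma sqint_projected_diff s t j : sqint (fun w => (Q *m x t w - Q *m x s w) j 0).
Proof.
have := sqintB (sqint_projected t j) (sqint_projected s j).
by congr sqint; apply/funext => w; rewrite !mxE.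
Qed.

Lemma projected_cauchy : history_means Pr x Ps us P u ->
  exists2 C : R, 0 < C & forall s t, (s <= t)%N ->
    \int[Pr]_w dotv (Q *m x t w - Q *m x s w) (Q *m x t w - Q *m x s w) <=
    C * gain_tail beta gamma s.
Proof.
move=> hist; have [M HM] := moments_bounded; have [C C0 HC] := noise_image_moment Q.
have M0 : 0 <= M by have := HM 0%N; have := p_ge0 0; have := v_ge0 0; lra.
apply: (@gain_tail_recurrence _ beta gamma beta_gt0 gamma_gt _
  (alpha ^+ 2 * (C * M))).
- by rewrite mulr_ge0 ?sqr_ge0// mulr_ge0.
- move=> s; under eq_Rintegral do rewrite subrr.
  rewrite (_ : dotv 0 0 = 0) ?Rintegral_cst ?mul0r//.
  by apply: big1 => i _; rewrite mxE mul0r.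
move=> s t st.
have -> : (fun w => dotv (Q *m x t.+1 w - Q *m x s w) (Q *m x t.+1 w - Q *m x s w)) =
    (fun w => dotv ((Q *m x t w - Q *m x s w) + (b t * k) *: (Q *m N t w))
                   ((Q *m x t w - Q *m x s w) + (b t * k) *: (Q *m N t w))).
  by apply/funext => w; rewrite projected_step addrAC.
rewrite integral_dotvD//; last 2 first.
- exact: sqint_projected_diff.
- have Ir r : itg (fun w => dotv (Q *m x r w) (Q *m N t w)).
    by apply: itg_dotv => j; [exact: sqint_projected|exact: sQN].
  under eq_Rintegral do rewrite dotvDl -scaleN1r dotvZl mulN1r.
  by rewrite RintegralB// !projected_noise_cross// subrr.
rewrite lerD2l bk2 mulrAC ler_wpM2r ?sqr_ge0// ler_wpM2l ?sqr_ge0//.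
by rewrite (le_trans (HC t))// ler_wpM2l.
Qed.

Lemma noise_mean s i : \int[Pr]_w N s w i 0 = 0.
Proof.
have [cP cu _] := xA1.
have [_ ->//] := noise_centered mPs mus x_traj xA1 i (sigma_stateE x s)
  (sigma_stateE x s i) (sqint_state mPs mus x_traj xA1 s i) (cP s) (cu s).
Qed.

Lemma projected_mean s i : \int[Pr]_w (Q *m x s w) i 0 = (Q *m x0) i 0.
Proof.
elim: s => [|s IH].
  have [x0E _] := x_traj; under eq_Rintegral do rewrite x0E.
  rewrite (Rintegral_cst Pr measurableT) [X in fine X](probability_setT Pr).
  by rewrite mulr1.
rewrite -IH; under eq_Rintegral do rewrite projected_step mxE [X in _ + X]mxE.
rewrite RintegralD//; last 2 first.
- by apply: sqint_itg; exact: sqint_projected.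
- by apply: itgZ; apply: sqint_itg; exact: sQN.
rewrite RintegralZl//; last by apply: sqint_itg; exact: sQN.
rewrite (_ : \int[Pr]_w (Q *m N s w) i 0 = 0) ?mulr0 ?addr0//.
under eq_Rintegral do rewrite mxE.
rewrite Rintegral_sum; last by move=> j; apply: itgZ; apply: sqint_itg; exact: sN.
apply: big1 => j _; rewrite RintegralZl ?noise_mean ?mulr0//.
by apply: sqint_itg; exact: sN.
Qed.

Lemma projected_limit : history_means Pr x Ps us P u ->
  exists z : T -> 'cV[R]_n,
  [/\ forall j, sqint (fun w => z w j 0),
      forall w, Q *m z w = z w,
      exists2 C : R, 0 < C & forall s,
        \int[Pr]_w dotv (Q *m x s w - z w) (Q *m x s w - z w) <=
        C * gain_tail beta gamma s &
      forall j, \int[Pr]_w z w j 0 = (Q *m x0) j 0].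
Proof.
move=> hist; have [C C0 HC] := projected_cauchy hist.
have small e : 0 < e ->
    exists m, forall s, (m <= s)%N -> C * gain_tail beta gamma s <= e.
  move=> e0; have [|m Hm] := @gain_tail_small _ beta gamma beta_gt0 gamma_gt (e / C).
    by rewrite divr_gt0.
  by exists m => s /Hm; rewrite ler_pdivlMr// mulrC.
have /choice[g Hg] : forall i, exists g, sqint g /\
    forall s, \int[Pr]_w (((Q *m x s w) i 0 - g w) ^+ 2) <= C * gain_tail beta gamma s.
  move=> i; have [s|s t st|//|g sg Hg] := @mean_square_limit _ _ _ Pr
    (fun s w => (Q *m x s w) i 0) (fun s => C * gain_tail beta gamma s).
  - exact: sqint_projected.
  - rewrite (le_trans _ (HC s t st))//.
    have sd := sqint_projected_diff s t.
    apply: le_Rintegral => //.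
    + by have [_] := sqintB (sqint_projected t i) (sqint_projected s i).
    + by apply: itg_dotv => j.
    by move=> w _; have := sqr_le_dotv (Q *m x t w - Q *m x s w) i; rewrite !mxE.
  - by exists g.
(* The coordinatewise limit is fixed by [Q] only almost surely. Taking [Q *m z0 w] as the limit
   makes it fixed at every point, at the cost of a larger constant in the rate. *)
pose z0 w := (\col_i g i w) : 'cV[R]_n.
have sz0 j : sqint (fun w => z0 w j 0).
  by have [sg _] := Hg j; move: sg; congr sqint; apply/funext => w; rewrite mxE.
have sz j : sqint (fun w => (Q *m z0 w) j 0) by move: j; apply: sqint_mulmx.
have [K1 K10 HK1] := dotv_mulmx_le Q.
have sd s j : sqint (fun w => (Q *m x s w - z0 w) j 0).
  have := sqintB (sqint_projected s j) (sz0 j).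
  by congr sqint; apply/funext => w; rewrite !mxE.
have Id s : itg (fun w => dotv (Q *m x s w - z0 w) (Q *m x s w - z0 w)).
  by apply: itg_dotv => j.
have sd' s j : sqint (fun w => (Q *m x s w - Q *m z0 w) j 0).
  have := sqintB (sqint_projected s j) (sz j).
  by congr sqint; apply/funext => w; rewrite !mxE.
have rate s : \int[Pr]_w dotv (Q *m x s w - Q *m z0 w) (Q *m x s w - Q *m z0 w) <=
    (K1 * n%:R + 1) * C * gain_tail beta gamma s.
  have t0 := gain_tail_gt0 gamma beta_gt0 s.
  apply: (@le_trans _ _ (K1 * (n%:R * (C * gain_tail beta gamma s)))); last first.
    by rewrite -[leRHS]mulrA mulrA ler_wpM2r ?lerDl// mulr_ge0// ltW.
  apply: (@le_trans _ _ (\int[Pr]_w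
      (K1 * dotv (Q *m x s w - z0 w) (Q *m x s w - z0 w)))).
    apply: le_Rintegral => //.
    - by apply: itg_dotv => j.
    - exact: itgZ.
    by move=> w _; rewrite -{1 3}QQ -!mulmxA -mulmxBr HK1.
  rewrite RintegralZl// ler_wpM2l//.
  rewrite /dotv Rintegral_sum; last by move=> j; exact: sqint_mul.
  rewrite mulr_natl -[X in _ *+ X]card_ord -sumr_const; apply: ler_sum => i _.
  rewrite (le_trans _ ((Hg i).2 s))// le_eqVlt; apply/orP; left; apply/eqP.
  by apply: eq_Rintegral => w _; rewrite !mxE expr2.
exists (fun w => Q *m z0 w); split => //.
- by move=> w; rewrite mulmxA QQ.
- exists ((K1 * n%:R + 1) * C) => //.
  by rewrite mulr_gt0// ltr_wpDl// mulr_ge0.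
move=> j; set D := (K1 * n%:R + 1) * C in rate.
have D0 : 0 < D by rewrite mulr_gt0// ltr_wpDl// mulr_ge0.
(* The mean of [Q *m x s w] does not depend on [s], so this defect is the mean of the difference at
   every time. By Jensen its square is below the rate, which tends to 0. *)
pose del := (Q *m x0) j 0 - \int[Pr]_w (Q *m z0 w) j 0.
have delE s : \int[Pr]_w ((Q *m x s w) j 0 - (Q *m z0 w) j 0) = del.
  rewrite RintegralB// ?projected_mean//; apply: sqint_itg => //.
  exact: sqint_projected.
have del_le s : del ^+ 2 <= D * gain_tail beta gamma s.
  rewrite (le_trans _ (rate s))//.
  have sh := sqintB (sqint_projected s j) (sz j); have [_ Ih] := sh.
  apply: (@le_trans _ _ (\int[Pr]_w (((Q *m x s w) j 0 - (Q *m z0 w) j 0) ^+ 2))).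
    have Ih1 := itgZ (2 * del) (sqint_itg sh).
    have Ic : itg (fun=> del ^+ 2) by exact: (sqint_itg (sqint_cst _ _)).
    have : 0 <= \int[Pr]_w (((Q *m x s w) j 0 - (Q *m z0 w) j 0) ^+ 2 -
        2 * del * ((Q *m x s w) j 0 - (Q *m z0 w) j 0) + del ^+ 2).
      apply: Rintegral_ge0 => w _; move: ((Q *m x s w) j 0 - (Q *m z0 w) j 0) => y.
      have -> : y ^+ 2 - 2 * del * y + del ^+ 2 = (y - del) ^+ 2 by ring.
      exact: sqr_ge0.
    rewrite (RintegralD measurableT (itgB Ih Ih1) Ic) (RintegralB measurableT Ih Ih1).
    rewrite RintegralZl ?delE//; last exact: sqint_itg.
    rewrite (Rintegral_cst Pr measurableT) [X in fine X](probability_setT Pr) mulr1.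
    by rewrite expr2; lra.
  apply: le_Rintegral => //.
    by apply: itg_dotv => i.
  by move=> w _; have := sqr_le_dotv (Q *m x s w - Q *m z0 w) j; rewrite !mxE.
apply/eqP; rewrite eq_sym -subr_eq0 -/del -sqrf_eq0; apply: contraT => d0.
have d_gt0 : 0 < del ^+ 2 by rewrite lt_def d0 sqr_ge0.
have [|m Hm] := @gain_tail_small _ beta gamma beta_gt0 gamma_gt (del ^+ 2 / (2 * D)).
  by rewrite divr_gt0// mulr_gt0.
have := le_trans (del_le m) (ler_wpM2l (ltW D0) (Hm m (leqnn m))).
rewrite (_ : D * _ = del ^+ 2 / 2); last by field; rewrite gt_eqF.
lra.
Qed.

End StochasticApproximation.

(** * From bounds on second moments to mean square convergence with a rate *)

Section MeanSquareRate.
Context d (T : measurableType d) (R : realType) (Pr : probability T R) (n : nat).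

Lemma expectation_norm2_sqr (y : T -> 'cV[R]_n) :
  (forall j, sqint Pr (fun w => y w j 0)) ->
  'E_Pr[fun w => (norm2 (y w) ^+ 2)%R]%E = (\int[Pr]_w dotv (y w) (y w))%:E.
Proof.
move=> sy; rewrite -Rintegral_fineK; last exact: itg_dotv.
by rewrite unlock; apply: eq_integral => w _; rewrite norm2_sqr.
Qed.

Lemma ms_cvg_rate (x : nat -> T -> 'cV[R]_n) (X : T -> 'cV[R]_n) (p C : R) :
  p < 0 -> 0 < C -> (forall j, sqint Pr (fun w => X w j 0)) ->
  (forall s j, sqint Pr (fun w => (x s w - X w) j 0)) ->
  (forall s, (1 <= s)%N ->
    \int[Pr]_w dotv (x s w - X w) (x s w - X w) <= C * s%:R `^ p) ->
  ms_cvg Pr x X /\ ms_rate Pr x X p.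
Proof.
move=> p0 C0 sX sxX HC.
have distE s : ms_dist Pr x X s = (\int[Pr]_w dotv (x s w - X w) (x s w - X w))%:E.
  by rewrite /ms_dist expectation_norm2_sqr.
split; last by exists C => // s s1; rewrite distE lee_fin HC.
split.
- by move=> i j; rewrite ord1; have [] := sX i.
- by rewrite expectation_norm2_sqr// ltry.
rewrite (_ : ms_dist Pr x X = EFin \o (fun s =>
    \int[Pr]_w dotv (x s w - X w) (x s w - X w))); last first.
  by apply/funext => s; rewrite distE.
apply: cvg_EFin; first by apply: nearW.
apply/cvgrPdist_le => e e0.
have [N HN] := powR_neg_small p0 (divr_gt0 e0 C0).
exists (maxn N 1) => // s /=; rewrite geq_max => /andP[Ns s1].
rewrite sub0r normrN ger0_norm; last first.
  by apply: Rintegral_ge0 => w _; exact: dotv_ge0.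
by rewrite (le_trans (HC s s1))// mulrC -ler_pdivlMr// HN.
Qed.

End MeanSquareRate.

(** * The threshold on the gain factor, and the compatibility of the projector with A3 *)

Section Threshold.
Context {R : realType}.

(* The spectral projector is unique, so the threshold depends on [B] only. *)
Lemma gain_threshold n (B : 'M[R]_n) : (0 < n)%N ->
  exists2 alpha0 : R, 0 < alpha0 & forall Q, spectral_projector B Q ->
    hurwitz (B - Q) -> exists (L : 'M[R]_(n + n, n)) (c K : R),
    [/\ 0 < c, 0 <= K, forall alpha, alpha0 < alpha -> 1 <= c * alpha,
      forall v, dotv (L *m v) (L *m ((B - Q) *m v)) <= - c * dotv (L *m v) (L *m v) &
      forall v, dotv v v <= K * dotv (L *m v) (L *m v)].
Proof.
move=> n0; have [[Q0 [BQ0 hQ0]]|noQ] :=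
  pselect (exists Q, spectral_projector B Q /\ hurwitz (B - Q)); last first.
  (* Without a suitable projector the requirement is vacuous, and any positive threshold will do. *)
  by exists 1 => // Q BQ hQ; exfalso; apply: noQ; exists Q.
have [L [c [K [c0 K0 Lc LK]]]] := hurwitz_lyapunov n0 hQ0.
exists c^-1 => [|Q BQ hQ]; first by rewrite invr_gt0.
rewrite (spectral_projector_uniq BQ BQ0); exists L, c, K; split => // alpha ca.
by rewrite mulrC -ler_pdivrMr// mul1r ltW.
Qed.

(** Every nonzero row of [Q] is a left eigenvector of [P] for the eigenvalue 1, so [A3] applies row
    by row. *)
Lemma A3_projector n (P Q : 'M[R]_n) (u : 'cV[R]_n) :
  A3 P u -> Q *m P = Q -> Q *m u = 0.
Proof.
move=> [_ _ Pu] QP; apply: mxC_inj; apply/row_matrixP => i.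
rewrite mxCM row_mul [RHS](_ : _ = 0); last by apply/matrixP => j l; rewrite !mxE.
have [->|r0] := eqVneq (row i (mxC Q)) 0; first by rewrite mul0mx.
by apply: Pu => //; rewrite -row_mul -mxCM QP.
Qed.

End Threshold.

(** * The strict and the critical cases *)

Section MeanSquareConvergence.
Context d (T : measurableType d) (R : realType) (Pr : probability T R) (n : nat).
Variables (Ps : nat -> T -> 'M[R]_n) (us : nat -> T -> 'cV[R]_n).
Variables (P : 'M[R]_n) (u : 'cV[R]_n) (a : nat -> R) (x0 : 'cV[R]_n).
Variable x : nat -> T -> 'cV[R]_n.
Hypothesis mPs : forall s, random_mx (Ps s).
Hypothesis mus : forall s, random_mx (us s).
Hypothesis x_traj : trajectory x a Ps us x0.
Hypothesis xA1 : A1 Pr x Ps us P u.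
Variables (k alpha beta gamma : R).
Hypothesis kk : k * k = 1.
Hypothesis alpha_gt0 : 0 < alpha.
Hypotheses (beta_gt0 : 0 < beta) (gamma_gt : 1 < 2 * gamma).
Hypothesis gamma_le1 : gamma <= 1.
Hypothesis aE : forall s, a s = k * (alpha * gain beta gamma s).
Let B := k *: (P - 1%:M).
Variable alpha0 : R.
Hypothesis alpha0_lt : alpha0 < alpha.
Hypothesis threshold : forall Q, spectral_projector B Q ->
    hurwitz (B - Q) -> exists (L : 'M[R]_(n + n, n)) (c K : R),
    [/\ 0 < c, 0 <= K, forall alpha, alpha0 < alpha -> 1 <= c * alpha,
      forall v, dotv (L *m v) (L *m ((B - Q) *m v)) <= - c * dotv (L *m v) (L *m v) &
      forall v, dotv v v <= K * dotv (L *m v) (L *m v)].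

Lemma stable_case : hurwitz B ->
  let X : T -> 'cV[R]_n := cst (invmx (1%:M - P) *m u) in
  ms_cvg Pr x X /\ ms_rate Pr x X (- gamma).
Proof.
move=> hB /=; set x_inf := invmx (1%:M - P) *m u.
have Bu := hurwitz_unit hB.
have k0 : k != 0 by apply: contraTneq (oner_neq0 R) => k0; rewrite -kk k0 mulr0 eqxx.
have Pu : 1%:M - P \in unitmx.
  have -> : 1%:M - P = (- k) *: B.
    by rewrite /B scalerA mulNr kk scaleN1r opprB.
  by rewrite unitmxZ// unitfE oppr_eq0.
have B0 : spectral_projector B 0 by split; rewrite ?mulmx0 ?mul0mx ?subr0.
have hB0 : hurwitz (B - 0) by rewrite subr0.
have [L [c [K [c0 K0 /(_ _ alpha0_lt) ca Lc LK]]]] := threshold B0 hB0.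
have [_ QB BQ _] := B0.
have Bx : B *m x_inf = - (k *: u).
  rewrite /B /x_inf -scalemxAl -opprB mulNmx mulKVmx// scalerN//.
have [C C0 HC] := error_rate mPs mus x_traj xA1 kk alpha_gt0 beta_gt0 gamma_gt
  gamma_le1 aE (mulmx0 _ 0) QB BQ (mul0mx _ u) (mul0mx _ x_inf) Bx c0 K0 ca Lc LK.
have errE s w : error x 0 x_inf s w = x s w - x_inf.
  by rewrite /error mul0mx subr0.
apply: (@ms_cvg_rate _ _ _ _ _ _ _ _ C) => //.
- by have := gamma_gt; lra.
- by move=> j; exact: sqint_cst.
- move=> s j; have := sqint_error mPs mus x_traj xA1 0 x_inf s j.
  by congr sqint; apply/funext => w; rewrite errE.
move=> s s1; have := HC s; under eq_Rintegral do rewrite errE.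
by move=> /le_trans; apply; rewrite ler_wpM2l ?(ltW C0)// gain_le_powR.
Qed.

Lemma critical_case : A3 P u -> history_means Pr x Ps us P u ->
  (forall l, eigenvalue (mxC P) l -> k * (complex.Re l - 1) <= 0) ->
  forall (r m : nat) (e : n = (r + m)%N) (H : 'M[R[i]]_n) (D_ : 'M[R[i]]_m),
  r = alg_mult (mxC P) 1 -> H \in unitmx ->
  mxC P = invmx H *m
    castmx (esym e, esym e) (block_mx 1%:M 0 0 D_ : 'M[R[i]]_(r + m)) *m H ->
  exists (X : T -> 'cV[R]_n) (ybar : T -> 'cV[R[i]]_r),
    [/\ ms_cvg Pr x X, ms_rate Pr x X (1 - 2 * gamma),
        [/\ random_mxC ybar,
            expectation_mxC Pr ybar
              (usubmx (castmx (e, erefl 1%N) (H *m mxC x0) : 'cV[R[i]]_(r + m)))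
          & ('E_Pr[fun w => (norm2C (ybar w) ^+ 2)%R] < +oo)%E]
      & forall w, mxC (X w) = invmx H *m castmx (esym e, erefl 1%N)
          (col_mx (ybar w) (invmx (1%:M - D_) *m
             dsubmx (castmx (e, erefl 1%N) (H *m mxC u) : 'cV[R[i]]_(r + m))))].
Proof.
move=> PA3 hist kP r m e H D_ r_mult Hu PE.
have [A3l _ _] := PA3.
have [Q [QE BQp hBQ]] := jordan_projector r_mult Hu PE kk A3l kP.
have [L [c [K [c0 K0 /(_ _ alpha0_lt) ca Lc LK]]]] := threshold BQp hBQ.
have [QQ QB BQ BQu] := BQp.
have QP : Q *m P = Q.
  have : k *: (Q *m B) = 0 by rewrite QB scaler0.
  rewrite /B -scalemxAr scalerA kk scale1r mulmxBr mulmx1 => /eqP.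
  by rewrite subr_eq0 => /eqP.
have Qu := A3_projector PA3 QP.
(* [B] may be singular, so the equation is solved with [B - Q]. Applying [Q] to it then gives
   [Q *m x_inf = 0], and [x_inf] also solves the equation for [B]. *)
pose x_inf := - (k *: (invmx (B - Q) *m u)).
have BQx : (B - Q) *m x_inf = - (k *: u).
  by rewrite /x_inf mulmxN -scalemxAr mulKVmx.
clearbody x_inf.
have Qx : Q *m x_inf = 0.
  have Qku : Q *m (k *: u) = 0 by rewrite -(scalemxAr k) Qu scaler0.
  have := congr1 (mulmx Q) BQx; rewrite (mulmxA Q) (mulmxBr Q) QB QQ sub0r mulNmx.
  by rewrite (mulmxN Q) Qku => /oppr_inj.
have Bx : B *m x_inf = - (k *: u) by rewrite -BQx mulmxBl Qx subr0.
have Px : (1%:M - P) *m x_inf = u.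
  have := congr1 ( *:%R (- k)) Bx; rewrite scalemxAl scalerA mulNr kk scaleN1r opprB.
  by rewrite scalerN scalerA mulNr kk scaleN1r opprK.
have [C1 C10 H1] := error_rate mPs mus x_traj xA1 kk alpha_gt0 beta_gt0 gamma_gt
  gamma_le1 aE QQ QB BQ Qu Qx Bx c0 K0 ca Lc LK.
have [z [sz Qz [C2 C20 H2] Ez]] := projected_limit mPs mus x_traj xA1 kk alpha_gt0
  beta_gt0 gamma_gt aE QQ QB BQ Qu Qx Bx c0 K0 Lc LK hist.
pose X w := z w + x_inf.
pose ybar w : 'cV[R[i]]_r :=
  usubmx (castmx (e, erefl 1%N) (H *m mxC (z w)) : 'cV[R[i]]_(r + m)).
have sX j : sqint Pr (fun w => X w j 0).
  by move: j; apply: sqint_vecD => // j; exact: sqint_cst.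
have xXE s w : x s w - X w = (Q *m x s w - z w) + error x Q x_inf s w.
  by rewrite /X /error; apply/matrixP => i j; rewrite !mxE; ring.
have serr s j := sqint_error mPs mus x_traj xA1 Q x_inf s j.
have sQz s j : sqint Pr (fun w => (Q *m x s w - z w) j 0).
  have := sqintB (sqint_projected mPs mus x_traj xA1 Q s j) (sz j).
  by congr sqint; apply/funext => w; rewrite !mxE.
have sxX s j : sqint Pr (fun w => (x s w - X w) j 0).
  have := sqint_vecD (sQz s) (serr s) j.
  by congr sqint; apply/funext => w; rewrite xXE.
have [X_cvg X_rate] : ms_cvg Pr x X /\ ms_rate Pr x X (1 - 2 * gamma).
  apply: (@ms_cvg_rate _ _ _ _ _ _ _ _ (2 * (C1 + C2))) => //.
  - by have := gamma_gt; lra.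
  - by rewrite mulr_gt0// addr_gt0.
  move=> s s1.
  have I1 := itg_dotv (sQz s) (sQz s); have I2 := itg_dotv (serr s) (serr s).
  apply: (@le_trans _ _ (\int[Pr]_w (2 *
    (dotv (Q *m x s w - z w) (Q *m x s w - z w) +
     dotv (error x Q x_inf s w) (error x Q x_inf s w))))).
    apply: le_Rintegral => //.
    - exact: itg_dotv.
    - exact: (itgZ 2 (itgD I1 I2)).
    by move=> w _; rewrite xXE dotvD_le.
  rewrite (RintegralZl 2 measurableT (itgD I1 I2)) (RintegralD measurableT I1 I2).
  rewrite -mulrA ler_wpM2l// addrC mulrDl lerD//.
    rewrite (le_trans (H1 s))// ler_wpM2l ?(ltW C10)//.
    rewrite (le_trans (gain_le_powR beta_gt0 gamma_gt s1))//.
    (* The faster rate of the error is absorbed: - gamma <= 1 - 2 gamma because gamma <= 1. *)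
    by rewrite ler_powR ?ler1n//; have := gamma_le1; lra.
  by rewrite (le_trans (H2 s))// ler_wpM2l ?(ltW C20)// gain_tail_le_powR.
have upE (y : 'cV[R[i]]_n) i :
    usubmx (castmx (e, erefl 1%N) y : 'cV[R[i]]_(r + m)) i 0 =
    y (cast_ord (esym e) (lshift m i)) 0.
  by rewrite mxE castmxE /= cast_ord_id.
have ReyE w i : complex.Re (ybar w i 0) =
    (map_mx (@complex.Re R) H *m z w) (cast_ord (esym e) (lshift m i)) 0.
  by rewrite -mulmx_mxC_Re -upE.
have ImyE w i : complex.Im (ybar w i 0) =
    (map_mx (@complex.Im R) H *m z w) (cast_ord (esym e) (lshift m i)) 0.
  by rewrite -mulmx_mxC_Im -upE.
have sRey i : sqint Pr (fun w => complex.Re (ybar w i 0)).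
  have := sqint_mulmx (map_mx (@complex.Re R) H) sz (cast_ord (esym e) (lshift m i)).
  by congr sqint; apply/funext => w; rewrite ReyE.
have sImy i : sqint Pr (fun w => complex.Im (ybar w i 0)).
  have := sqint_mulmx (map_mx (@complex.Im R) H) sz (cast_ord (esym e) (lshift m i)).
  by congr sqint; apply/funext => w; rewrite ImyE.
have Emul (A : 'M[R]_n) i : \int[Pr]_w (A *m z w) i 0 = (A *m (Q *m x0)) i 0.
  under eq_Rintegral do rewrite mxE.
  rewrite [RHS]mxE Rintegral_sum => [|j]; last by apply: itgZ; exact: sqint_itg.
  by apply: eq_bigr => j _; rewrite RintegralZl ?Ez//; exact: sqint_itg.
have EE f : sqint Pr f -> 'E_Pr[f]%E = (\int[Pr]_w f w)%:E.
  by move=> sf; rewrite unlock Rintegral_fineK//; exact: sqint_itg.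
exists X, ybar; split=> //; last first.
  move=> w; exact: (jordan_reconstruct Hu (lower_unit r_mult Hu PE) PE QE (Qz w) Qx Px).
split.
- by move=> i j; rewrite ord1; split; [have [] := sRey i|have [] := sImy i].
- move=> i j; rewrite ord1 -(jordan_upper _ Hu QE) !EE//; split.
    under eq_Rintegral do rewrite ReyE.
    by rewrite Emul -mulmx_mxC_Re upE.
  under eq_Rintegral do rewrite ImyE.
  by rewrite Emul -mulmx_mxC_Im upE.
have Iy : Pr.-integrable setT (EFin \o (fun w => norm2C (ybar w) ^+ 2)).
  have : Pr.-integrable setT (EFin \o (fun w => \sum_i
      (complex.Re (ybar w i 0) ^+ 2 + complex.Im (ybar w i 0) ^+ 2))).
    by apply: itg_sum => i; apply: itgD; [have [] := sRey i|have [] := sImy i].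
  congr (Pr.-integrable _ (EFin \o _)); apply/funext => w.
  rewrite /norm2C sqr_sqrtr; last by apply: sumr_ge0 => i _; exact: sqr_ge0.
  apply: eq_bigr => i _; case: (ybar w i 0) => p q /=.
  by rewrite sqr_sqrtr// addr_ge0// sqr_ge0.
by rewrite unlock Rintegral_fineK// ltry.
Qed.

End MeanSquareConvergence.

Theorem theorem3p2 (R : realType) (n : nat) (n_gt0 : (0 < n)%N)
    (P : 'M[R]_n) :
  exists2 alpha0 : R, 0 < alpha0 &
  forall (alpha beta gamma : R),
    alpha0 < alpha -> 0 < beta -> 1 / 2 < gamma -> gamma <= 1 ->
  forall (d : measure_display) (Omega : measurableType d)
    (Pr : probability Omega R)
    (Ps : nat -> Omega -> 'M[R]_n) (us : nat -> Omega -> 'cV[R]_n)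
    (u : 'cV[R]_n) (a : nat -> R) (x0 : 'cV[R]_n)
    (x : nat -> Omega -> 'cV[R]_n),
    (forall s, random_mx (Ps s)) -> (forall s, random_mx (us s)) ->
    trajectory x a Ps us x0 ->
    A1 Pr x Ps us P u ->
    (rho_max P <= 1 /\
       (forall s : nat, a s = alpha / (s%:R + beta) `^ gamma)) \/
    (1 <= rho_min P /\
       (forall s : nat, a s = - alpha / (s%:R + beta) `^ gamma)) ->
    (rho_max P < 1 \/ 1 < rho_min P ->
       let X : Omega -> 'cV[R]_n := cst (invmx (1%:M - P) *m u) in
       ms_cvg Pr x X /\ ms_rate Pr x X (- gamma)) /\
    (rho_max P = 1 \/ rho_min P = 1 ->
     A3 P u -> history_means Pr x Ps us P u ->
     forall (r m : nat) (e : n = (r + m)%N)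
       (H : 'M[R[i]]_n) (D_ : 'M[R[i]]_m),
       let D : 'M[R[i]]_(r + m) := block_mx 1%:M 0 0 D_ in
       let split (v : 'cV[R[i]]_n) : 'cV[R[i]]_(r + m) :=
         castmx (e, erefl 1%N) v in
       let unsplit (y : 'cV[R[i]]_(r + m)) : 'cV[R[i]]_n :=
         castmx (esym e, erefl 1%N) y in
       r = alg_mult (mxC P) 1 ->
       H \in unitmx ->
       jordan_form D ->
       mxC P = invmx H *m castmx (esym e, esym e) D *m H ->
       exists (X : Omega -> 'cV[R]_n) (ybar : Omega -> 'cV[R[i]]_r),
         [/\ ms_cvg Pr x X,
             ms_rate Pr x X (1 - 2 * gamma),
             [/\ random_mxC ybar,
                 expectation_mxC Pr ybar (usubmx (split (H *m mxC x0)))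
               & ('E_Pr[fun w => (norm2C (ybar w) ^+ 2)%R] < +oo)%E]
           & forall w, mxC (X w) = invmx H *m unsplit (col_mx (ybar w)
               (invmx (1%:M - D_) *m dsubmx (split (H *m mxC u))))]).
Proof.
have [a1 a1_gt0 thr1] := gain_threshold (1 *: (P - 1%:M)) n_gt0.
have [a2 a2_gt0 thr2] := gain_threshold ((-1) *: (P - 1%:M)) n_gt0.
(* The threshold is fixed before the sign of the gain is known, so it must exceed those of both
   signs. *)
exists (a1 + a2) => [|alpha beta gamma a_lt beta_gt0 gamma_gt2 gamma_le1].
  by rewrite addr_gt0.
move=> d Omega Pr Ps us u a x0 x mPs mus x_traj xA1 sgn.
have gamma_gt : 1 < 2 * gamma by move: gamma_gt2; rewrite ltr_pdivrMr// mulrC.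
have alpha_gt0 : 0 < alpha by lra.
have [k [alpha0 [kk aE a0_lt thr [kle klt]]]] : exists k alpha0 : R,
  [/\ k * k = 1, forall s, a s = k * (alpha * gain beta gamma s), alpha0 < alpha,
    (forall Q, spectral_projector (k *: (P - 1%:M)) Q ->
    hurwitz (k *: (P - 1%:M) - Q) -> exists (L : 'M[R]_(n + n, n)) (c K : R),
    [/\ 0 < c, 0 <= K, forall alpha, alpha0 < alpha -> 1 <= c * alpha,
      forall v, dotv (L *m v) (L *m ((k *: (P - 1%:M) - Q) *m v)) <=
        - c * dotv (L *m v) (L *m v) &
      forall v, dotv v v <= K * dotv (L *m v) (L *m v)]) &
    (forall l, eigenvalue (mxC P) l -> k * (complex.Re l - 1) <= 0) /\
    (rho_max P < 1 \/ 1 < rho_min P ->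
      forall l, eigenvalue (mxC P) l -> k * (complex.Re l - 1) < 0)].
  (* Excludes the strict inequality on the side opposite to the sign of the gain. *)
  have mM := rho_min_le_max P n_gt0.
  case: sgn => -[rho aE]; [exists 1, a1|exists (-1), a2]; split=> //.
  - by rewrite mulr1.
  - by move=> s; rewrite aE mul1r.
  - by lra.
  - split=> [l /le_rho_max|h l /le_rho_max] hl; first lra.
    by case: h => h; lra.
  - by rewrite mulrNN mulr1.
  - by move=> s; rewrite aE mulN1r mulNr.
  - by lra.
  split=> [l /ge_rho_min|h l /ge_rho_min] hl; first lra.
  by case: h => h; lra.
split=> [strict|crit PA3 hist r m e H D_ D split unsplit r_mult Hu _ PE].
  apply: (stable_case mPs mus x_traj xA1 kk alpha_gt0 beta_gt0 gamma_gt gamma_le1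
    aE a0_lt thr).
  by apply: hurwitz_off_line => //; exact: klt.
exact: (critical_case mPs mus x_traj xA1 kk alpha_gt0 beta_gt0 gamma_gt gamma_le1
    aE a0_lt thr PA3 hist kle r_mult Hu PE).
Qed.
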